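(* Suppose that $(H_\alpha)$ holds for some $\alpha>1$. For each $u\in\mathbb{Z}^d\setminus\{0\}$ set $\mu(u)=\mathbb{P}_p(0\in C_\infty)f_u$, where $f_u\ge0$ is the constant such that $d(0,T_{n,u}u)/n\to f_u$ $\overline{\mathbb{P}}$-a.s., and set $\mu(0)=0$. Then for each $u\in\mathbb{Z}^d\setminus\{0\}$, $$\lim_{n\to\infty}\frac{d(0,T_{n,u}u)}{T_{n,u}}=\mu(u)\quad\overline{\mathbb{P}}\text{-a.s.}$$ Moreover, the function $\mu:\mathbb{Z}^d\to[0,\infty)$ has the following properties: \begin{enumerate} \item For any $u\in\mathbb{Z}^d$, $\mu(-u)=\mu(u)$. If, moreover, $S_\nu$ is a product measure $\nu^{\otimes\mathbb{E}^d}$, then $\mu$ is invariant under permutations and reflections of the coordinates in $\mathbb{Z}^d$. \item For any $k\in\mathbb{Z}$ and any $u\in\mathbb{Z}^d$, $\mu(ku)=|k|\mu(u)$. \item For any $u\in\mathbb{Z}^d$, $\mu(u)\le\rho m\|u\|_1$ and $\mu(u)\le\mu_*\|u\|_1$, where $\mu_*=\sup_{1\le i\le d}\mu(e_i)$. \item For any $u,v\in\mathbb{Z}^d$, $\mu(u+v)\le\mu(u)+\mu(v)$. \item For any $u,v\in\mathbb{Z}^d$, $|\mu(u)-\mu(v)|\le\mu_*\|u-v\|_1$. \end{enumerate}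
   Context: Percolation. Let $d\ge 2$, let $\mathbb{E}^d$ be the set of non-oriented edges between points of $\mathbb{Z}^d$ at Euclidean distance $1$, let $p_c=p_c(d)$ be the critical probability of Bernoulli bond percolation on $\mathbb{Z}^d$, and let $p\in(p_c,1]$. Let $\Omega_E=\{0,1\}^{\mathbb{E}^d}$ and $\mathbb{P}_p=(p\delta_1+(1-p)\delta_0)^{\otimes\mathbb{E}^d}$. An edge $e$ is open in $\omega\in\Omega_E$ if $\omega(e)=1$; a nearest-neighbour path is open if all its edges are. $x\leftrightarrow y$ means that $x,y$ are in the same open cluster. $C_\infty$ is the set of points whose open cluster is infinite. $\overline{\mathbb{P}}_p$ is $\mathbb{P}_p$ conditioned on $\{0\in C_\infty\}$. The chemical distance $D(x,y)$ is the minimal number of edges of an open path from $x$ to $y$ ($+\infty$ if none). $\|y\|_1=\sum_i|y_i|$ and $(e_1,\dots,e_d)$ is the canonical basis. $\rho=\rho(p,d)\in[1,\infty)$ is a constant, which exists by a theorem of Antal and Pisztora, such that for some $A_0,B_0>0$: $\mathbb{P}_p(0\leftrightarrow y,\ D(0,y)>\rho\|y\|_1)\le A_0\exp(-B_0\|y\|_1)$ for all $y\in\mathbb{Z}^d$. Passage times. Let $\Omega_S=\mathbb{R}_+^{\mathbb{E}^d}$ and let $S_\nu$ be a probability measure on $\Omega_S$. $\mathbb{Z}^d$ acts by $(\theta_u\eta)_e=\eta_{u.e}$ with $u.\{a,b\}=\{a+u,b+u\}$. Standing assumptions: $S_\nu$ is invariant under all $\theta_u$, $u\in\mathbb{Z}^d$,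 and ergodic for $\theta_u$ for each $u\in\mathbb{Z}^d\setminus\{0\}$; and $m=\sup_{e\in\mathbb{E}^d}\int\eta_e\,dS_\nu(\eta)<+\infty$. Put $\overline{\mathbb{P}}=\overline{\mathbb{P}}_p\otimes S_\nu$ on $\Omega_E\times\Omega_S$. The travel time is $d(x,y)(\omega,\eta)=\inf_\gamma\sum_{e\in\gamma}\eta_e$, infimum over paths from $x$ to $y$ open in $\omega$ ($+\infty$ if none). Assumption $(H_\alpha)$: there exist $A,B>0$ such that for every finite nonempty $\Lambda\subseteq\mathbb{E}^d$, $S_\nu\left(\sum_{e\in\Lambda}\eta_e\ge B|\Lambda|\right)\le A/|\Lambda|^\alpha$. For $u\in\mathbb{Z}^d\setminus\{0\}$, $T_{n,u}$ is the $n$-th integer $k\ge1$ such that $ku\in C_\infty$. It is known (under the standing assumptions) that $d(0,T_{n,u}u)/n$ converges $\overline{\mathbb{P}}$-a.s. to a constant $f_u\ge0$. *)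

(* Defs.v *)
From HB Require Import structures.
From mathcomp Require Import all_boot all_order all_algebra.
From mathcomp Require Import finmap.
From mathcomp Require Import all_classical all_reals all_analysis.

Set Implicit Arguments.
Unset Strict Implicit.
Unset Printing Implicit Defensive.
Import Order.TTheory GRing.Theory Num.Theory.
Import numFieldNormedType.Exports.

Local Open Scope classical_set_scope.
Local Open Scope ring_scope.

Definition product_display : measure_display -> measure_display.
Proof. exact. Qed.

Definition product_space (I : Type) (T : Type) : Type := I -> T.

Section product_space.
Context {d} (I : Type) (T : measurableType d).

HB.instance Definition _ := Pointed.copy (product_space I T) (I -> T).

Definition cylinders : set (set (product_space I T)) :=
  [set C | exists i (A : set T), measurable A /\ C = [set w | A (w i)]].

Let product0 : <<s cylinders >> set0. Proof. exact: sigma_algebra0. Qed.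

Let productC A : <<s cylinders >> A -> <<s cylinders >> (~` A).
Proof. exact: sigma_algebraC. Qed.

Let productU (F : (set (product_space I T))^nat) :
  (forall i, <<s cylinders >> (F i)) -> <<s cylinders >> (\bigcup_i F i).
Proof. exact: sigma_algebra_bigcup. Qed.

HB.instance Definition _ := @isMeasurable.Build (product_display d)
  (product_space I T) <<s cylinders >> product0 productC productU.

Lemma measurable_cylinder (i : I) (A : set T) :
  measurable A -> measurable [set w : product_space I T | A (w i)].
Proof. by move=> mA; apply: sub_sigma_algebra; exists i, A. Qed.

End product_space.

(* P is the product of copies of nu indexed by I, characterised by its values
   on finite-dimensional rectangles. *)
Definition iid_law {R : realType} {d} {I : choiceType} {T : measurableType d}
    (nu : probability T R) (P : probability (product_space I T) R) : Prop :=
  forall (J : {fset I}) (A : I -> set T), (forall i, measurable (A i)) ->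
    P [set w | forall i, i \in J -> A i (w i)] =
    (\prod_(i <- J) nu (A i))%E.

(* When P C = 0 the library's mnormalize returns the junk value P. *)
Definition conditioned {R : realType} {d} {T : measurableType d}
    (P : probability T R) (C : set T) (mC : measurable C) : probability T R :=
  mnormalize (mrestr P mC) P.

Definition nnreal (R : realType) : Type := {nonneg R}.

Definition nnreal_display : measure_display.
Proof. exact: default_measure_display. Qed.

Section nnreal.
Variable R : realType.

HB.instance Definition _ := Choice.copy (nnreal R) {nonneg R}.
HB.instance Definition _ := isPointed.Build (nnreal R) (0%R%:nng : {nonneg R}).

Definition nnreal_measurable : set (set (nnreal R)) :=
  preimage_set_system setT (fun x : nnreal R => x%:num) measurable.

Let nnreal0 : nnreal_measurable set0.
Proof. by exists set0 => //; rewrite preimage_set0 setI0. Qed.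

Let nnrealC A : nnreal_measurable A -> nnreal_measurable (~` A).
Proof.
move=> [B mB <-]; exists (~` B); first exact: measurableC.
by rewrite !setTI preimage_setC.
Qed.

Let nnrealU (F : (set (nnreal R))^nat) :
  (forall i, nnreal_measurable (F i)) -> nnreal_measurable (\bigcup_i F i).
Proof.
move=> mF.
have /choice[G HG] i : exists B : set R, measurable B /\
    setT `&` (fun x : nnreal R => x%:num) @^-1` B = F i.
  by have [B mB BF] := mF i; exists B.
exists (\bigcup_i G i).
  by apply: bigcupT_measurable => i; have [] := HG i.
rewrite setTI preimage_bigcup; apply: eq_bigcupr => i _.
by have [_ <-] := HG i; rewrite setTI.
Qed.

HB.instance Definition _ := @isMeasurable.Build nnreal_display
  (nnreal R) nnreal_measurable nnreal0 nnrealC nnrealU.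

End nnreal.

(* The coordinates are integers, so Euclidean distance 1 means squared
   distance 1. *)
Definition is_edge d (e : {fset 'rV[int]_d}) : bool :=
  `[< exists x y : 'rV[int]_d,
        e = [fset x; y]%fset /\ \sum_i (x 0 i - y 0 i) ^+ 2 = 1 >].

Definition edge (d : nat) : Type := {e : {fset 'rV[int]_d} | is_edge e}.

HB.instance Definition _ d := Countable.copy (edge d)
  {e : {fset 'rV[int]_d} | is_edge e}.

Section lattice.
Variable d : nat.
Implicit Types (x y z u : 'rV[int]_d) (e : edge d) (g : seq (edge d)).

Definition l1norm u : int := \sum_i `|u 0 i|.

Lemma is_edge_shift u e : is_edge [fset (x + u)%R | x in val e]%fset.
Proof.
case: e => e /= /asboolP[x [y [-> xy]]]; apply/asboolP.
exists (x + u), (y + u); split; first by rewrite imfset_fset2.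
by rewrite -xy; apply: eq_bigr => i _; rewrite !mxE opprD addrACA subrr addr0.
Qed.

Definition shift_edge u e : edge d :=
  exist _ [fset (x + u)%R | x in val e]%fset (is_edge_shift u e).

(* A path from x to y is given by the list of its successive edges. Edges may
   be repeated: this does not change an infimum of nonnegative costs. *)
Fixpoint walk x g y : Prop :=
  if g is e :: g' then exists2 z, val e = [fset x; z]%fset & walk z g' y
  else x = y.

End lattice.

Definition Omega_E (d : nat) := product_space (edge d) bool.

Section percolation.
Variable d : nat.
Implicit Types (w : Omega_E d) (x y : 'rV[int]_d) (g : seq (edge d)).

Definition open_walk w x g y : Prop := walk x g y /\ forall e, e \in g -> w e.

Definition linked w x y : Prop := exists g, open_walk w x g y.

Definition Cinf w : set 'rV[int]_d :=
  [set x | infinite_set [set y | linked w x y]].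

Definition percolates x : set (Omega_E d) := [set w | Cinf w x].

Lemma measurable_linked x y : measurable [set w | linked w x y].
Proof.
have -> : [set w | linked w x y] =
    \bigcup_(g : seq (edge d)) [set w | open_walk w x g y].
  by apply/seteqP; split=> w [g] => [xgy|_ xgy]; exists g.
apply: countable_bigcupT_measurable => [|g]; first exact: countableP.
have [xgy|nxgy] := pselect (walk x g y); last first.
  rewrite (_ : [set w | _] = set0) ?measurable0//.
  by apply/seteqP; split => // w [].
rewrite (_ : [set w | _] = [set w : Omega_E d | forall e, e \in g -> w e]); last first.
  by apply/seteqP; split => w //= [].
elim: g {xgy} => [|e g IH].
  by rewrite (_ : [set w | _] = setT) ?measurableT//; apply/seteqP; split.
rewrite (_ : [set w | _] = [set w : Omega_E d | w e] `&`
    [set w : Omega_E d | forall e, e \in g -> w e]); last first.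
  apply/seteqP; split => w /= => [we|[we wg] e'].
    by split=> [|e' e'g]; apply: we; rewrite inE ?eqxx// e'g orbT.
  by rewrite inE => /predU1P[->//|]; apply: wg.
by apply: measurableI => //; exact: (@measurable_cylinder _ _ bool e [set b | is_true b]).
Qed.

Lemma measurable_percolates x : measurable (percolates x).
Proof.
have -> : percolates x = ~` (\bigcup_(F : {fset 'rV[int]_d})
    ~` (\bigcup_y [set w | y \notin F /\ linked w x y])).
  apply/seteqP; split=> w /=.
    move=> inf [F _]; apply; apply: contrapT => nF; apply: inf.
    apply: (@sub_finite_set _ _ [set` F]) => [y /= xy|]; last exact: finite_fset.
    by apply: contrapT => /negP yF; apply: nF; exists y.
  move=> H /finite_fsetP[F FE]; apply: H; exists F => // -[y _ [/negP yF xy]].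
  by apply: yF; have : [set y | linked w x y] y by []; rewrite FE.
apply: measurableC; apply: countable_bigcupT_measurable => [|F].
  exact: countableP.
apply: measurableC; apply: countable_bigcupT_measurable => [|y].
  exact: countableP.
have [yF|yF] := boolP (y \in F).
  rewrite (_ : [set w | _] = set0) ?measurable0//.
  by apply/seteqP; split => // w [].
rewrite (_ : [set w | _] = [set w | linked w x y]).
  exact: measurable_linked.
by apply/seteqP; split => w //= [].
Qed.

End percolation.

Definition chemical_distance (R : realType) d (w : Omega_E d)
    (x y : 'rV[int]_d) : \bar R :=
  ereal_inf [set (size g)%:R%:E | g in [set g | open_walk w x g y]].

Definition critical_probability (R : realType) (d : nat) : R :=
  sup [set q : R | 0 <= q <= 1 /\
    exists2 P : probability (Omega_E d) R,
      iid_law (bernoulli_prob q) P & P (percolates 0) = 0%E].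

Definition chemical_constant (R : realType) d
    (Pp : probability (Omega_E d) R) (rho : R) : Prop :=
  1 <= rho /\ exists A B : R, [/\ 0 < A, 0 < B & forall y : 'rV[int]_d,
    (Pp [set w | linked w 0 y /\
           (rho * (l1norm y)%:~R)%:E < chemical_distance R w 0 y] <=
     (A * expR (- B * (l1norm y)%:~R))%:E)%E].

Definition Omega_S (R : realType) (d : nat) :=
  product_space (edge d) (nnreal R).

Section passage_times.
Variables (R : realType) (d : nat).
Implicit Types (S : probability (Omega_S R d) R) (w : Omega_E d)
  (eta : Omega_S R d) (u x y : 'rV[int]_d).

Definition translate u eta : Omega_S R d := fun e => eta (shift_edge u e).

Definition stationary S : Prop := forall u (A : set (Omega_S R d)),
  measurable A -> S (translate u @^-1` A) = S A.

Definition ergodic S : Prop := forall u, u != 0 ->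
  forall A : set (Omega_S R d), measurable A ->
    translate u @^-1` A = A -> S A = 0%E \/ S A = 1%E.

Definition sup_mean S : \bar R :=
  ereal_sup (range (fun e : edge d => (\int[S]_eta (eta e)%:num%:E)%E)).

Definition H_ S (alpha : R) : Prop :=
  exists A B : R, [/\ 0 < A, 0 < B &
    forall L : {fset edge d}, L != fset0 ->
      (S [set eta | (B * #|` L|%:R <= \sum_(e <- L) (eta e)%:num)%R] <=
       (A / #|` L|%:R `^ alpha)%:E)%E].

Definition travel_time w eta x y : \bar R :=
  ereal_inf [set (\sum_(e <- g) (eta e)%:num)%:E |
             g in [set g | open_walk w x g y]].

(* The n-th k >= 1 such that k u is in the infinite cluster, 0 if there is
   none. *)
Definition T_ w n u : nat :=
  xget 0%N [set k | [/\ (1 <= k)%N, Cinf w (u *+ k) &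
    (\sum_(1 <= j < k.+1 | `[< Cinf w (u *+ j) >]) 1)%N = n]].

Definition Pbar (Pp : probability (Omega_E d) R) S :
    probability (Omega_E d * Omega_S R d)%type R :=
  (conditioned Pp (measurable_percolates 0) \x S)%E.

Definition mu_ (Pp : probability (Omega_E d) R) (f : 'rV[int]_d -> R) u : R :=
  if u == 0 then 0 else fine (Pp (percolates 0)) * f u.

Definition mu_star (mu : 'rV[int]_d -> R) : R :=
  sup (range (fun i : 'I_d => mu (delta_mx 0 i))).

End passage_times.

Definition reflect_coord d (i : 'I_d) (u : 'rV[int]_d) : 'rV[int]_d :=
  \row_j (if j == i then - u 0 j else u 0 j).

(* Main.v *)
(* Birkhoff's theorem for the indicators of {k u \in Cinf} gives
   n / T_{n,u} -> theta = Pp(0 \in Cinf) almost surely, whence the first limit with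
   mu u = theta f_u. Along k u \in Cinf this says that d(0, k u) / k -> mu u, hence,
   under Pp \x Snu, the probability that 0 and n u are in Cinf while d(0, n u) / n
   is not close to mu u tends to 0. Product measures are mixing of order three, so
   0, n u and n v lie simultaneously in Cinf with probability tending to
   theta ^ 3 > 0: for n large some configuration avoids all the bad events, and the
   algebraic properties of mu follow from those of d at that configuration,
   together with the invariance of the laws under lattice isomorphisms.

   For mu u <= rho m |u|_1, the theorem of Antal and Pisztora provides, with high
   probability, an open walk of length at most rho n |u|_1 from 0 to n u. If mu u
   were larger, Markov's inequality along that walk would bound the probability of
   {0, n u \in Cinf} by a factor strictly less than 1 of itself, up to o(1). *)

From HB Require Import structures.
Require Import Defs.
From mathcomp Require Import all_boot all_order all_algebra all_fingroup.
From mathcomp Require Import finmap.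
From mathcomp Require Import all_classical all_reals all_analysis.
From mathcomp Require Import measurable_realfun.
From mathcomp Require Import ring lra.

Set Implicit Arguments.
Unset Strict Implicit.
Unset Printing Implicit Defensive.
Import Order.TTheory GRing.Theory Num.Theory.
Import numFieldNormedType.Exports.
Local Open Scope classical_set_scope.
Local Open Scope ring_scope.

(** * Mixing of product measures *)

Section real_probability.
Context {R : realType} {d} {T : measurableType d} (P : probability T R).
Implicit Types A B : set T.

Definition prob A : R := fine (P A).

Lemma probE A : measurable A -> P A = (prob A)%:E.
Proof. by move=> mA; rewrite /prob fineK// fin_num_measure. Qed.

Lemma prob_ge0 A : 0 <= prob A.
Proof. by rewrite /prob fine_ge0. Qed.

Lemma probT : prob setT = 1.
Proof. by rewrite /prob probability_setT. Qed.

Lemma le_prob A B : measurable A -> measurable B -> A `<=` B ->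
  prob A <= prob B.
Proof.
move=> mA mB AB; rewrite -lee_fin -!probE//.
by apply: le_measure => //; rewrite inE.
Qed.

Lemma probD A B : measurable A -> measurable B -> B `<=` A ->
  prob (A `\` B) = prob A - prob B.
Proof.
move=> mA mB BA; apply: EFin_inj; rewrite EFinB -!probE//; last exact: measurableD.
by rewrite measureD// ?setIidr// [X in (X < _)%E]probE// ltry.
Qed.

Lemma probC A : measurable A -> prob (~` A) = 1 - prob A.
Proof. by move=> mA; rewrite -probT -probD// setTD. Qed.

Lemma le_probU A B : measurable A -> measurable B ->
  prob (A `|` B) <= prob A + prob B.
Proof.
move=> mA mB; rewrite -lee_fin EFinD -!probE//; last exact: measurableU.
exact: measureU2.
Qed.

Lemma nondecreasing_cvg_prob (F : (set T)^nat) :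
  (forall n, measurable (F n)) -> nondecreasing_seq F ->
  prob (F n) @[n --> \oo] --> prob (\bigcup_n F n).
Proof.
move=> mF ndF; have mU := bigcupT_measurable _ mF.
apply: fine_cvg; rewrite fineK ?fin_num_measure//.
exact: nondecreasing_cvg_mu.
Qed.

Lemma nonincreasing_cvg_prob (F : (set T)^nat) :
  (forall n, measurable (F n)) -> nonincreasing_seq F ->
  prob (F n) @[n --> \oo] --> prob (\bigcap_n F n).
Proof.
move=> mF niF; have mI := bigcapT_measurable mF.
apply: fine_cvg; rewrite fineK ?fin_num_measure//.
by apply: nonincreasing_cvg_mu => //; rewrite -ge0_fin_numE// fin_num_measure.
Qed.

(* The domination [m n A <= prob A] makes the convergence uniform in n along
   increasing unions, hence the convergent sets form a lambda-system. *)
Lemma cvg_lambda_system (G : set (set T)) (m : nat -> set T -> R) (c : R) :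
  measurable = <<s G >> -> setI_closed G ->
  (forall n A, measurable A -> 0 <= m n A <= prob A) ->
  (forall n A B, measurable A -> measurable B -> B `<=` A ->
     m n (A `\` B) = m n A - m n B) ->
  m n setT @[n --> \oo] --> c ->
  (forall A, G A -> m n A @[n --> \oo] --> c * prob A) ->
  forall A, measurable A -> m n A @[n --> \oo] --> c * prob A.
Proof.
move=> mG IG mP mD mT mc A mA.
pose H := [set A | measurable A /\ m n A @[n --> \oo] --> c * prob A].
suff : H A by case.
have GH : G `<=` H.
  by move=> B GB; split; [rewrite mG; apply: sub_sigma_algebra|exact: mc].
have : <<s G >> A by rewrite -mG.
apply: (@lambda_system_subset _ G IG setT H) => //; split => //.
- by split=> //; rewrite probT mulr1.
- move=> B C CB [mB Bc] [mC Cc]; split; first exact: measurableD.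
  rewrite probD// mulrBr.
  under eq_fun do rewrite mD//.
  exact: cvgB.
- move=> F ndF FH; have mF n : measurable (F n) by have [] := FH n.
  have mU := bigcupT_measurable _ mF.
  split=> //.
  have c01 : 0 <= c <= 1.
    apply/andP; split.
      apply: (cvgr_to_ge mT); apply: nearW => n.
      by have /andP[] := mP n _ (@measurableT _ T).
    apply: (cvgr_to_le mT); apply: nearW => n.
    by have /andP[_] := mP n _ (@measurableT _ T); rewrite probT.
  apply/cvgrPdist_lt => e e0.
  have e3 : 0 < e / 3 by lra.
  have /cvgrPdist_lt/(_ _ e3)[k _ Fk] := nondecreasing_cvg_prob mF ndF.
  have {}Fk := Fk k (leqnn k).
  have FU : F k `<=` \bigcup_n F n by move=> x Fx; exists k.
  have [_ /cvgrPdist_lt/(_ _ e3)] := FH k.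
  apply: filterS => n Fn.
  have /andP[U0 U1] := mP n _ (measurableD mU (mF k)).
  have := mD n _ _ mU (mF k) FU; rewrite probD// in U1.
  move: Fk; rewrite ger0_norm ?subr_ge0 ?le_prob// => Fk mE.
  have cp : 0 <= c * (prob (\bigcup_n F n) - prob (F k)) <= e / 3.
    have ? : 0 <= prob (\bigcup_n F n) - prob (F k) by rewrite subr_ge0 le_prob.
    apply/andP; split; first by nra.
    by case/andP: c01 => ? ?; nra.
  move: Fn; rewrite !ltr_norml; case/andP: cp; lra.
Qed.

Lemma probability_unique (Q : probability T R) (G : set (set T)) :
  measurable = <<s G >> -> setI_closed G -> G setT ->
  (forall A, G A -> P A = Q A) -> forall A, measurable A -> P A = Q A.
Proof.
move=> mG IG GT PQ A mA; apply: (measure_unique G (fun=> setT)) => //.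
- exact: bigcup_const.
- by move=> _; rewrite -ge0_fin_numE// fin_num_measure.
Qed.

End real_probability.

Section rectangles.
Context {R : realType} {d} {I : choiceType} {T : measurableType d}.
Notation space := (product_space I T).
Implicit Types (J K : {fset I}) (A B : I -> set T).

Definition rect J A : set space := [set w | forall i, i \in J -> A i (w i)].

Definition rects : set (set space) :=
  [set X | exists J A, (forall i, measurable (A i)) /\ X = rect J A].

Lemma rectE J A : rect J A = \bigcap_(i in [set` J]) [set w : space | A i (w i)].
Proof. by apply/seteqP; split=> w /=. Qed.

Lemma measurable_rect J A : (forall i, measurable (A i)) -> measurable (rect J A).
Proof.
move=> mA; rewrite rectE; apply: fin_bigcap_measurable => // i _.
exact: (@measurable_cylinder _ _ _ i (A i)).
Qed.

Lemma measurable_rects X : rects X -> measurable X.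
Proof. by move=> [J [A [mA ->]]]; exact: measurable_rect. Qed.

Lemma rectsT : rects setT.
Proof.
exists fset0, (fun=> setT); split => //.
by apply/seteqP; split.
Qed.

Lemma setI_closed_rects : setI_closed rects.
Proof.
move=> _ _ [J [A [mA ->]]] [K [B [mB ->]]].
exists (J `|` K)%fset,
  (fun i => (if i \in J then A i else setT) `&` (if i \in K then B i else setT)).
split=> [i|]; first by apply: measurableI; case: ifP.
apply/seteqP; split=> w /=.
  by move=> [wA wB] i _; split; case: ifP => // ?; [exact: wA|exact: wB].
move=> wAB; split=> i iJ.
  by have [] := wAB i; rewrite ?inE ?iJ.
by have [] := wAB i; rewrite ?inE ?iJ ?orbT.
Qed.

Lemma measurable_rectsE : @measurable _ space = <<s rects >>.
Proof.
apply/seteqP; split.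
  apply: smallest_sub; first exact: smallest_sigma_algebra.
  move=> _ [i [A [mA ->]]]; apply: sub_sigma_algebra.
  exists [fset i]%fset, (fun=> A); split=> //; apply/seteqP; split=> w /=.
    by move=> Aw j; rewrite inE => /eqP ->.
  by apply; rewrite inE.
by apply: smallest_sub; [exact: sigma_algebra_measurable|exact: measurable_rects].
Qed.

(** Reindexing by a map of the index set: translations and the other lattice isomorphisms act this
    way on both [Omega_E] and [Omega_S]. *)
Definition pull (s : I -> I) (w : space) : space := fun i => w (s i).

Lemma measurable_pull s : measurable_fun setT (pull s).
Proof.
apply: (measurability (@cylinders _ I T)) => //.
move=> _ [_ [i [A [mA ->]]] <-].
by rewrite setTI; exact: (@measurable_cylinder _ _ _ (s i) A).
Qed.

Lemma measurable_pull_preimage s (X : set space) : measurable X ->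
  measurable (pull s @^-1` X).
Proof. by move=> mX; rewrite -[_ @^-1` _]setTI; exact: measurable_pull. Qed.

Lemma pull_rect s s' J A : cancel s s' ->
  pull s @^-1` rect J A = rect [fset s i | i in J]%fset (A \o s').
Proof.
move=> sK; apply/seteqP; split=> w /=.
  by move=> wA _ /imfsetP[i /= iJ ->]; rewrite sK; exact: wA.
by move=> wA i iJ; have := wA (s i); rewrite /= sK; apply; rewrite in_imfset.
Qed.

HB.instance Definition _ s := isMeasurableFun.Build _ _ _ _ (pull s) (measurable_pull s).

Variables (nu : probability T R) (P : probability space R).
Hypothesis PE : iid_law nu P.

Lemma iid_rect J A : (forall i, measurable (A i)) ->
  P (rect J A) = (\prod_(i <- J) nu (A i))%E.
Proof. by move=> mA; rewrite -PE. Qed.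

(** An injective reindexing turns a rectangle into a rectangle over the image of its index set, with
    the same marginal factors; rectangles form a generating pi-system. *)
Lemma iid_pull s s' : cancel s s' -> forall X, measurable X ->
  P (pull s @^-1` X) = P X.
Proof.
move=> sK X mX.
apply: (probability_unique (P := distribution P (pull s))
  measurable_rectsE setI_closed_rects rectsT _ mX).
move=> _ [J [A [mA ->]]]; 
rewrite [LHS](_ : _ = P (pull s @^-1` rect J A))// (pull_rect _ _ sK).
rewrite !iid_rect// => [|i]; last exact: mA.
rewrite big_imfset/=; last by move=> i j _ _; exact: (can_inj sK).
by apply: eq_bigr => i _; rewrite sK.
Qed.

(** Independence over disjoint sets of coordinates. The intersection is also returned as a
    rectangle, so that a third one can be adjoined by a second application. *)
Lemma iid_rectI J K A B :
  (forall i, measurable (A i)) -> (forall i, measurable (B i)) ->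
  (forall i, i \in J -> i \in K -> False) ->
  P (rect J A `&` rect K B) = (P (rect J A) * P (rect K B))%E /\
  exists2 C, (forall i, measurable (C i)) &
    rect J A `&` rect K B = rect (J `|` K)%fset C.
Proof.
move=> mA mB JK; pose C i := if i \in J then A i else B i.
have mC i : measurable (C i) by rewrite /C; case: ifP.
have E : rect J A `&` rect K B = rect (J `|` K)%fset C.
  apply/seteqP; split=> w /=.
    move=> [wA wB] i; rewrite inE /C.
    by case: ifP => [iJ _|_ /= iK]; [exact: wA|exact: wB].
  move=> wC; split=> i iJ.
    by have := wC i; rewrite inE /C iJ; exact.
  have := wC i; rewrite inE /C iJ orbT.
  by case: ifP => [iJ'|_]; [case: (JK i)|exact].
split; last by exists C.
rewrite E !iid_rect// (big_fsetID _ (fun i => i \in J)) /=; congr (_ * _)%E.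
  transitivity (\prod_(i <- J) nu (C i))%E.
    by apply: eq_fbigl => i; rewrite !inE andbC; case: (i \in J).
  by rewrite !big_seq; apply: eq_bigr => i iJ; rewrite /C iJ.
transitivity (\prod_(i <- K) nu (C i))%E.
  apply: eq_fbigl => i; rewrite !inE.
  have := JK i; case: (i \in J); case: (i \in K) => //= H.
  by case: H.
rewrite !big_seq; apply: eq_bigr => i iK; rewrite /C; case: ifP => // iJ.
by case: (JK i).
Qed.

(* Direct on rectangles, then extended to A, B and C one after the other by
   cvg_lambda_system. *)
Lemma iid_mixing (a b c a' b' c' : nat -> I -> I) (A B C : set space) :
  (forall n, cancel (a n) (a' n)) -> (forall n, cancel (b n) (b' n)) ->
  (forall n, cancel (c n) (c' n)) ->
  (forall i j, \forall n \near \oo, a n i != b n j) ->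
  (forall i j, \forall n \near \oo, a n i != c n j) ->
  (forall i j, \forall n \near \oo, b n i != c n j) ->
  measurable A -> measurable B -> measurable C ->
  prob P (pull (a n) @^-1` A `&` pull (b n) @^-1` B `&` pull (c n) @^-1` C)
    @[n --> \oo] --> prob P A * prob P B * prob P C.
Proof.
move=> aK bK cK ab ac bc mA mB mC.
have mp s X : measurable X -> measurable (pull s @^-1` X).
  exact: measurable_pull_preimage.
have prob_pull s s' : cancel s s' -> forall X, measurable X ->
    prob P (pull s @^-1` X) = prob P X.
  by move=> sK X mX; rewrite /prob (iid_pull sK).
pose F n (X Y Z : set space) :=
  prob P (pull (a n) @^-1` X `&` pull (b n) @^-1` Y `&` pull (c n) @^-1` Z).
have mF n X Y Z : measurable X -> measurable Y -> measurable Z ->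
    measurable (pull (a n) @^-1` X `&` pull (b n) @^-1` Y `&` pull (c n) @^-1` Z).
  by move=> mX mY mZ; do 2?[apply: measurableI]; exact: mp.
(* Two finite index sets give finitely many pairs, each of them eventually separated. *)
have near_disj (s t : nat -> I -> I) J K :
    (forall i j, \forall n \near \oo, s n i != t n j) ->
    \forall n \near \oo, forall i,
      i \in [fset s n x | x in J]%fset -> i \in [fset t n x | x in K]%fset -> False.
  move=> st.
  have : \forall n \near \oo, forall x, x \in J -> forall y, y \in K -> s n x != t n y.
    apply: (filterS (P := \bigcap_(x in [set` J]) \bigcap_(y in [set` K])
      [set n | s n x != t n y])) => [n H x xJ y yK|]; first exact: H.
    by do 2?[apply: filter_bigI => ? _]; exact: st.
  apply: filterS => n H _ /imfsetP[x /= xJ ->] /imfsetP[y /= yK] /eqP.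
  exact/negP/H.
have rectF : forall X Y Z, rects X -> rects Y -> rects Z ->
    F n X Y Z @[n --> \oo] --> prob P X * prob P Y * prob P Z.
  move=> _ _ _ [J [X [mX ->]]] [K [Y [mY ->]]] [L [Z [mZ ->]]].
  (* Once the three index sets have been moved apart, independence gives the exact product, so the
     sequence is eventually constant. *)
  apply: cvg_near_cst; near=> n.
  have mr K' W : (forall i, measurable (W i)) ->
      (product_display d).-measurable (rect K' W) by exact: measurable_rect.
  rewrite /F -(prob_pull _ _ (aK n) _ (mr J X mX)).
  rewrite -(prob_pull _ _ (bK n) _ (mr K Y mY)).
  rewrite -(prob_pull _ _ (cK n) _ (mr L Z mZ)).
  rewrite (pull_rect _ _ (aK n)) (pull_rect _ _ (bK n)) (pull_rect _ _ (cK n)).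
  have mX' i : measurable ((X \o a' n) i) by exact: mX.
  have mY' i : measurable ((Y \o b' n) i) by exact: mY.
  have mZ' i : measurable ((Z \o c' n) i) by exact: mZ.
  have JK : forall i, i \in [fset a n x | x in J]%fset ->
    i \in [fset b n x | x in K]%fset -> False by near: n; exact: near_disj.
  have JL : forall i, i \in [fset a n x | x in J]%fset ->
    i \in [fset c n x | x in L]%fset -> False by near: n; exact: near_disj.
  have KL : forall i, i \in [fset b n x | x in K]%fset ->
    i \in [fset c n x | x in L]%fset -> False by near: n; exact: near_disj.
  have [E [V mV EV]] := iid_rectI mX' mY' JK.
  have JKL i : i \in ([fset a n x | x in J] `|` [fset b n x | x in K])%fset ->
      i \in [fset c n x | x in L]%fset -> False.
    by rewrite inE => /orP[]; [exact: JL|exact: KL].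
  have [E' _] := iid_rectI mV mZ' JKL.
  apply: EFin_inj; rewrite !EFinM -!probE; try exact: mr; last first.
    by do 2?[apply: measurableI]; exact: mr.
  by rewrite EV E' -EV E.
(* Extension in one argument, the other two being gathered in [U n]; the domination comes from the
   invariance of P under [pull]. *)
have step (s s' : nat -> I -> I) (U : nat -> set space) (k : R) :
    (forall n, cancel (s n) (s' n)) -> (forall n, measurable (U n)) ->
    prob P (U n) @[n --> \oo] --> k ->
    (forall X, rects X ->
      prob P (pull (s n) @^-1` X `&` U n) @[n --> \oo] --> k * prob P X) ->
    forall X, measurable X ->
      prob P (pull (s n) @^-1` X `&` U n) @[n --> \oo] --> k * prob P X.
  move=> sK mU Uk rk.
  apply: (cvg_lambda_system (m := fun n X => prob P (pull (s n) @^-1` X `&` U n))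
    measurable_rectsE setI_closed_rects) => //.
  - move=> n X mX; rewrite prob_ge0 -(prob_pull _ _ (sK n) X)// le_prob//.
      by apply: measurableI => //; exact: mp.
    exact: mp.
  - move=> n X Y mX mY YX.
    rewrite -probD; [|by apply: measurableI => //; exact: mp..|].
      congr prob; apply/seteqP; split=> w /=; tauto.
    by move=> w [/YX].
  - by under eq_fun do rewrite preimage_setT setTI.
have p3 X Y Z n : pull (a n) @^-1` X `&` pull (b n) @^-1` Y `&` pull (c n) @^-1` Z =
    pull (b n) @^-1` Y `&` (pull (a n) @^-1` X `&` pull (c n) @^-1` Z).
  by rewrite -setIA setICA.
have limA X Y Z : measurable X -> rects Y -> rects Z ->
    F n X Y Z @[n --> \oo] --> prob P X * prob P Y * prob P Z.
  move=> mX rY rZ; rewrite -mulrA [X in _ --> X]mulrC /F.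
  have mY := measurable_rects rY; have mZ := measurable_rects rZ.
  under eq_fun do rewrite -setIA.
  apply: (step a a') => // [n||V rV].
  - by apply: measurableI; exact: mp.
  - have := rectF setT Y Z rectsT rY rZ; rewrite probT mul1r /F.
    by under eq_fun do rewrite preimage_setT setTI.
  - rewrite [X in _ --> X]mulrC mulrA; under eq_fun do rewrite setIA.
    exact: rectF.
have limB X Y Z : measurable X -> measurable Y -> rects Z ->
    F n X Y Z @[n --> \oo] --> prob P X * prob P Y * prob P Z.
  move=> mX mY rZ; rewrite mulrAC /F.
  have mZ := measurable_rects rZ.
  under eq_fun do rewrite p3.
  apply: (step b b') => // [n||V rV].
  - by apply: measurableI; exact: mp.
  - have := limA X setT Z mX rectsT rZ; rewrite probT mulr1 /F.
    by under eq_fun do rewrite preimage_setT setIT.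
  - rewrite mulrAC; under eq_fun do rewrite -p3.
    exact: limA.
under eq_fun do rewrite setIC.
apply: (step c c') => // [n||V rV].
- by apply: measurableI; exact: mp.
- have := limB A B setT mA mB rectsT; rewrite probT mulr1 /F.
  by under eq_fun do rewrite preimage_setT setIT.
- by under eq_fun do rewrite setIC; exact: limB.
Unshelve. all: by end_near. Qed.

End rectangles.

(** * Visits of an ergodic transformation *)

Section ergodic_frequency.
Context {R : realType} {d} {T : measurableType d} (P : probability T R).
Variable t : T -> T.
Hypothesis mt : measurable_fun setT t.
Hypothesis Pt : forall X, measurable X -> P (t @^-1` X) = P X.
Implicit Types (A B X : set T) (x : T) (q : R).

Definition visits A n x : R := \sum_(0 <= j < n) \1_A (iter j t x).

Lemma visitsD A m n x : visits A (m + n) x = visits A m x + visits A n (iter m t x).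
Proof.
rewrite /visits !big_mkord big_split_ord/=; congr (_ + _).
by apply: eq_bigr => j _; rewrite addnC iterD.
Qed.

Lemma visits1 A x : visits A 1 x = \1_A x.
Proof. by rewrite /visits big_nat1. Qed.

Lemma visits_ge0 A n x : 0 <= visits A n x.
Proof. by apply: sumr_ge0. Qed.

Lemma visits_le A n x : visits A n x <= n%:R.
Proof.
rewrite (_ : n%:R = \sum_(j < n) 1); last by rewrite sumr_const card_ord.
by rewrite /visits big_mkord; apply: ler_sum => j _; rewrite indicE lern1 leq_b1.
Qed.

Lemma visitsC A n x : visits (~` A) n x = n%:R - visits A n x.
Proof.
rewrite (_ : n%:R = \sum_(j < n) 1); last by rewrite sumr_const card_ord.
rewrite /visits !big_mkord -sumrB.
by apply: eq_bigr => j _; rewrite !indicE in_setC; case: (_ \in A); rewrite ?subrr ?subr0.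
Qed.

Lemma measurable_iter j : measurable_fun setT (iter j t).
Proof.
elim: j => [|j IH] /=; first exact: measurable_id.
exact: (measurableT_comp mt).
Qed.

Lemma measure_iter j X : measurable X -> P (iter j t @^-1` X) = P X.
Proof.
move=> mX; elim: j => [//|j IH].
rewrite -[RHS]IH -[RHS]Pt; last first.
  by rewrite -[_ @^-1` _]setTI; exact: measurable_iter.
by congr (P _); apply/seteqP; split=> x /=; rewrite -iterSr.
Qed.

Lemma measurable_visits A n : measurable A -> measurable_fun setT (visits A n).
Proof.
move=> mA; rewrite /visits; apply: measurable_sum => j.
by apply: measurableT_comp; [exact: measurable_indic|exact: measurable_iter].
Qed.

Lemma integral_visits A n : measurable A ->
  (\int[P]_x (visits A n x)%:E)%E = (n%:R * prob P A)%:E.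
Proof.
move=> mA; rewrite /visits.
under eq_integral do rewrite -sumEFin.
rewrite ge0_integral_sum//; last first.
  by move=> j; apply/measurable_EFinP; apply: measurableT_comp;
    [exact: measurable_indic|exact: measurable_iter].
rewrite (eq_bigr (fun=> (prob P A)%:E)) => [|j _].
  by rewrite sumEFin big_mkord sumr_const card_ord mulr_natl.
have mi : measurable (iter j t @^-1` A).
  by rewrite -[_ @^-1` _]setTI; exact: measurable_iter.
rewrite -probE// -(measure_iter j mA) -[in RHS](setIT (_ @^-1` _)) -integral_indic//.
Qed.

(** The bound N on the waiting time keeps the blocks of [visits_blocks], and hence the remainder, of
    bounded length. *)
Definition early N A q := [set x | exists2 n, (1 <= n <= N)%N & q * n%:R < visits A n x].

(* Cut an orbit of length L greedily into blocks of frequency at least q,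
   single steps from outside [early N A q], and a remainder shorter than N. *)
Lemma visits_blocks A N q L x : 0 <= q <= 1 ->
  q * (L%:R - N%:R) <= visits A L x + visits (~` early N A q) L x.
Proof.
move=> /andP[q0 q1]; elim/ltn_ind: L x => L IH x.
have [LN|NL] := leqP L N.
  rewrite (@le_trans _ _ 0)//; last by rewrite addr_ge0// visits_ge0.
  by rewrite mulr_ge0_le0// subr_le0 ler_nat.
have [[n /andP[n1 nN] qn]|xB] := pselect (early N A q x).
  have nL : (n <= L)%N by rewrite (leq_trans nN)// ltnW.
  have := IH (L - n)%N; rewrite ltn_subrL n1 (leq_ltn_trans _ NL)// => /(_ erefl (iter n t x)).
  rewrite natrB// -(subnKC nL) !visitsD (subnKC nL).
  have := visits_ge0 (~` early N A q) n x; nra.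
case: L NL IH => // L NL IH.
have := IH L (ltnSn L) (t x); rewrite -add1n !visitsD !visits1.
rewrite [\1_(~` _) x]indicE mem_set// -natr1.
have : 0 <= (\1_A x : R) by [].
rewrite /=; nra.
Qed.

Lemma measurable_gt_visits A q n : measurable A ->
  measurable [set x | q < visits A n x].
Proof.
move=> mA; rewrite (_ : [set x | _] = setT `&` visits A n @^-1` `]q, +oo[%classic).
  exact: measurable_visits.
by apply/seteqP; split=> x /=; rewrite in_itv/= andbT => // -[].
Qed.

Lemma measurable_early N A q : measurable A -> measurable (early N A q).
Proof.
move=> mA; rewrite (_ : early N A q =
  \bigcup_(n in [set n | (1 <= n <= N)%N]) [set x | q * n%:R < visits A n x]).
  by apply: bigcup_measurable => n _; exact: measurable_gt_visits.
by apply/seteqP; split=> x [n]; exists n.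
Qed.

(** Integrating [visits_blocks] and dividing by L bounds q, up to an error of order N / L, by
    [prob P A] plus the probability of the complement of [early N A q]. Both errors are made small
    by taking N and then L large. *)
Lemma le_prob_frequency A q : measurable A -> 0 <= q <= 1 ->
  P (\bigcup_N early N A q) = 1%E -> q <= prob P A.
Proof.
move=> mA q01 PE; have mE N : measurable (early N A q) := measurable_early N q mA.
have ndE : nondecreasing_seq (fun N => early N A q).
  move=> N M NM; apply/subsetPset => x [n /andP[n1 nN] qn].
  by exists n => //; rewrite n1 (leq_trans nN).
have := nondecreasing_cvg_prob (P := P) mE ndE; rewrite [in X in _ --> X]/prob PE /= => PE1.
apply/ler_addgt0Pr => e e0; have e2 : 0 < e / 2 by lra.
have /cvgrPdist_lt/(_ _ e2)[N _ /(_ N (leqnn N))] := PE1.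
set b := prob P (early N A q) => bN.
have {}bN : prob P (~` early N A q) < e / 2.
  by rewrite probC//; move: bN; rewrite ltr_norml => /andP[]; rewrite /b; lra.
have bound L : (N <= L)%N ->
    q * (L%:R - N%:R) <= L%:R * (prob P A + prob P (~` early N A q)).
  move=> NL; have mC := measurableC (mE N).
  rewrite [leRHS]mulrDr -lee_fin EFinD -(integral_visits L mA) -(integral_visits L mC).
  have mv X : measurable X -> measurable_fun setT (fun x => (visits X L x)%:E).
    by move=> mX; apply/measurable_EFinP; exact: measurable_visits.
  rewrite -ge0_integralD//; last 4 first.
  - by move=> x _; rewrite lee_fin visits_ge0.
  - exact: mv.
  - by move=> x _; rewrite lee_fin visits_ge0.
  - exact: mv.
  rewrite -[leLHS]mule1 -(@probability_setT _ _ _ P) -integral_cst//.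
  apply: ge0_le_integral => //.
  - by move=> x _; rewrite lee_fin mulr_ge0 ?subr_ge0 ?ler_nat//; case/andP: q01.
  - by apply: emeasurable_funD; exact: mv.
  - by move=> x _; rewrite -EFinD lee_fin visits_blocks.
have [L [L0 NL LN]] : exists L : nat, [/\ (0 < L)%N, (N <= L)%N & N%:R < (e / 2) * L%:R].
  exists (N + (Num.truncn (N%:R / (e / 2))).+1)%N.
  split; [by rewrite addnS|by rewrite leq_addr|].
  rewrite [ltRHS]mulrC -ltr_pdivrMr// (lt_le_trans (truncnS_gt _))//.
  by rewrite ler_nat leq_addl.
have := bound L NL; have Lgt0 : 0 < L%:R :> R by rewrite ltr0n.
case/andP: q01 => q0 q1.
have : q * N%:R <= N%:R by rewrite ler_piMl.
have : L%:R * prob P (~` early N A q) < L%:R * (e / 2) by rewrite ltr_pM2l.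
by rewrite -(ler_pM2l Lgt0); nra.
Qed.

Hypothesis ergodic_t : forall X, measurable X -> t @^-1` X = X ->
  P X = 0%E \/ P X = 1%E.

(** Lies between limsup > q and limsup >= q for the frequencies [visits A n x / n]. *)
Definition often A q :=
  [set x | forall m, exists2 n, (m <= n)%N & q * n%:R < visits A n x].

Lemma measurable_often A q : measurable A -> measurable (often A q).
Proof.
move=> mA; rewrite (_ : often A q = \bigcap_m \bigcup_(n in [set n | (m <= n)%N])
    [set x | q * n%:R < visits A n x]).
  apply: bigcapT_measurable => m; apply: bigcup_measurable => n _.
  exact: measurable_gt_visits.
apply/seteqP; split=> x H m; first by move=> _; have [n] := H m; exists n.
by have [n] := H m I; exists n.
Qed.

Lemma often_anti A q q' : q <= q' -> often A q' `<=` often A q.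
Proof.
move=> qq' x H m; have [n mn qn] := H m; exists n => //.
by rewrite (le_lt_trans _ qn)// ler_wpM2r.
Qed.

(** Passing from x to [t x] changes time and count by at most one, which the gap between q and r
    absorbs at large times. Thus [often] is invariant up to a loss in the threshold. *)
Lemma often_shift A q r x : q < r ->
  (often A r (t x) -> often A q x) /\ (often A r x -> often A q (t x)).
Proof.
move=> qr; pose K := (Num.truncn ((1 + `|q|) / (r - q))).+1.
have Kn n : (K <= n)%N -> 1 + `|q| < (r - q) * n%:R.
  move=> Kn; rewrite mulrC -ltr_pdivrMr ?subr_gt0//.
  by rewrite (lt_le_trans (truncnS_gt _))// ler_nat.
have vS n : visits A n.+1 x = \1_A x + visits A n (t x).
  by rewrite -add1n visitsD visits1.
have q_norm := ler_norm q; have q_norm' := lerNnormlW (lexx `|q|).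
have i0 : 0 <= (\1_A x : R) by [].
have i1 : (\1_A x : R) <= 1 by rewrite indicE lern1 leq_b1.
split=> H m.
  have [n mn rn] := H (maxn m K); exists n.+1.
    by rewrite (leq_trans _ (leqW mn))// leq_maxl.
  have := Kn n (leq_trans (leq_maxr _ _) mn).
  rewrite vS -natr1; nra.
have [[|n] mn rn] := H (maxn m K).+1; first by [].
rewrite ltnS in mn.
exists n; first by rewrite (leq_trans _ mn)// leq_maxl.
have := Kn n (leq_trans (leq_maxr m _) mn).
move: rn; rewrite vS -natr1; nra.
Qed.

(** If the frequency exceeded q infinitely often with positive probability, ergodicity would make it
    exceed some r > [prob P A] almost surely, against [le_prob_frequency]. *)
Lemma ae_not_often A q : measurable A -> prob P A < q -> P (often A q) = 0%E.
Proof.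
move=> mA Aq; pose r := (prob P A + q) / 2.
have [Ar rq] : prob P A < r /\ r < q by rewrite /r; split; lra.
(* The union over thresholds decreasing to r is exactly invariant: a shift of the orbit only costs
   one step in k. *)
pose F := \bigcup_k often A (r + k.+1%:R^-1).
have mF : measurable F by apply: bigcupT_measurable => k; exact: measurable_often.
have halve k : r + k.+2%:R^-1 < r + k.+1%:R^-1 :> R.
  by rewrite ltrD2l ltf_pV2 ?posrE// ltr_nat.
have tF : t @^-1` F = F.
  apply/seteqP; split=> x [k _ H]; exists k.+1 => //=.
  - exact: (often_shift A x (halve k)).1 H.
  - exact: (often_shift A x (halve k)).2 H.
have r0 : 0 <= r by rewrite (le_trans (prob_ge0 P A))// ltW.
have FB : F `<=` \bigcup_N early N A r.
  move=> x [k _ /(_ 1%N)[n n1 rn]]; exists n => //=; exists n; first by rewrite n1 leqnn.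
  by rewrite (le_lt_trans _ rn)// ler_wpM2r// lerDl.
have [F0|F1] := ergodic_t mF tF.
  apply/eqP; rewrite -measure_le0 -F0; apply: le_measure; rewrite ?inE//.
    exact: measurable_often.
  have [k kr] : exists k : nat, k.+1%:R^-1 < q - r.
    exists (Num.truncn (q - r)^-1).
    rewrite -[ltRHS]invrK ltf_pV2 ?posrE ?invr_gt0 ?subr_gt0//.
    exact: truncnS_gt.
  by move=> x H; exists k => //; apply: often_anti H; rewrite -lerBrDl ltW.
have mE N : measurable (early N A r) := measurable_early N r mA.
have mU : measurable (\bigcup_N early N A r) := bigcupT_measurable _ mE.
have E1 : P (\bigcup_N early N A r) = 1%E.
  apply/eqP; rewrite eq_le probability_le1//=.
  apply: (@le_trans _ _ (P F)); first by rewrite F1.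
  by apply: le_measure; rewrite ?inE.
have r1 : r <= 1.
  have [x [N _ [n /andP[n1 _] rn]]] : \bigcup_N early N A r !=set0.
    by apply/set0P/eqP => E0; move: E1; rewrite E0 measure0 => /eqP; rewrite eq_sym onee_eq0.
  have := lt_le_trans rn (visits_le A n x).
  have : 0 < n%:R :> R by rewrite ltr0n.
  by nra.
have := le_prob_frequency mA _ E1; rewrite r0 r1 => /(_ erefl).
by rewrite leNgt Ar.
Qed.

(** Birkhoff's theorem for an indicator: [ae_not_often] bounds the upper limit when applied to A,
    and the lower limit when applied to the complement of A. *)
Lemma ae_cvg_visits A : measurable A ->
  {ae P, forall x, visits A n x / n%:R @[n --> \oo] --> prob P A}.
Proof.
move=> mA; have mC := measurableC mA.
pose q B k := prob P B + k.+1%:R^-1 : R.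
have ae_q B : measurable B -> {ae P, forall x, forall k, ~ often B (q B k) x}.
  move=> mB; apply: ae_foralln => k; exists (often B (q B k)); split.
  - exact: measurable_often.
  - by apply: ae_not_often => //; rewrite ltrDl.
  - by move=> x /= /contrapT.
have := ae_q _ mA; have := ae_q _ mC.
apply: filterS2 => x HC HA; apply/cvgrPdist_le => e e0.
pose k := Num.truncn e^-1.
have ke : k.+1%:R^-1 < e.
  by rewrite -[ltRHS]invrK ltf_pV2 ?posrE ?invr_gt0//; exact: truncnS_gt.
have ev B : ~ often B (q B k) x -> \forall n \near \oo, visits B n x <= q B k * n%:R.
  move=> /existsNP[m Hm]; exists m => // n /= mn; rewrite leNgt; apply/negP => H.
  by apply: Hm; exists n.
have := ev _ (HC k); have := ev _ (HA k); apply: filterS3 (nbhs_infty_gt 0).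
move=> n n0 HAn; rewrite visitsC /q probC// => HCn.
have n0' : 0 < n%:R :> R by rewrite ltr0n.
move: ke HAn HCn; rewrite /q; move: (k.+1%:R^-1) => i ie HAn HCn.
have h1 : visits A n x / n%:R <= prob P A + i by rewrite ler_pdivrMr.
have h2 : prob P A - i <= visits A n x / n%:R by rewrite ler_pdivlMr//; lra.
by rewrite ler_norml; apply/andP; split; lra.
Qed.

End ergodic_frequency.

(** * Lattice isomorphisms and travel times *)

Section lattice_isomorphisms.
Variable d : nat.
Implicit Types (x y z u : 'rV[int]_d) (e : edge d) (g h : seq (edge d)).

(** The edge map is a field, tied to the vertex map through endpoints, so that [shift_iso] can use
    [shift_edge] itself; storing the inverses makes [iso_sym] immediate. *)
Record lattice_iso := LatticeIso {
  iso :> 'rV[int]_d -> 'rV[int]_d;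
  iso_inv : 'rV[int]_d -> 'rV[int]_d;
  iso_edge : edge d -> edge d;
  iso_edge_inv : edge d -> edge d;
  isoK : cancel iso iso_inv;
  iso_invK : cancel iso_inv iso;
  val_iso_edge : forall e, val (iso_edge e) = [fset iso x | x in val e]%fset;
  val_iso_edge_inv :
    forall e, val (iso_edge_inv e) = [fset iso_inv x | x in val e]%fset }.

Definition iso_sym (s : lattice_iso) : lattice_iso :=
  LatticeIso (iso_invK s) (isoK s) (val_iso_edge_inv s) (val_iso_edge s).

Lemma iso_edgeK (s : lattice_iso) : cancel (iso_edge s) (iso_edge_inv s).
Proof.
move=> e; apply: val_inj; rewrite val_iso_edge_inv val_iso_edge.
apply/fsetP => x; apply/imfsetP/idP => [[_ /imfsetP[y /= ye ->] ->]|xe].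
  by rewrite isoK.
by exists (s x); rewrite ?isoK//; apply/imfsetP; exists x.
Qed.

Lemma iso_edge_invK (s : lattice_iso) : cancel (iso_edge_inv s) (iso_edge s).
Proof. exact: (iso_edgeK (iso_sym s)). Qed.

Lemma shift_edgeE u e : val (shift_edge u e) = [fset (x + u)%R | x in val e]%fset.
Proof. by []. Qed.

Definition shift_iso u : lattice_iso :=
  LatticeIso (addrK u) (subrK u) (shift_edgeE u) (shift_edgeE (- u)).

Lemma is_edge_imfset (tau : 'rV[int]_d -> 'rV[int]_d) e :
  (forall x y, \sum_i (tau x 0 i - tau y 0 i) ^+ 2 = \sum_i (x 0 i - y 0 i) ^+ 2) ->
  is_edge [fset tau x | x in val e]%fset.
Proof.
case: e => e /= /asboolP[x [y [-> xy]]] tauE; apply/asboolP.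
by exists (tau x), (tau y); rewrite tauE xy imfset_fset2.
Qed.

Section isometry.
Variables tau tau' : 'rV[int]_d -> 'rV[int]_d.
Hypotheses (tauK : cancel tau tau') (tau'K : cancel tau' tau).
Hypothesis tauE : forall x y,
  \sum_i (tau x 0 i - tau y 0 i) ^+ 2 = \sum_i (x 0 i - y 0 i) ^+ 2.

Let tau'E x y :
  \sum_i (tau' x 0 i - tau' y 0 i) ^+ 2 = \sum_i (x 0 i - y 0 i) ^+ 2.
Proof. by rewrite -tauE !tau'K. Qed.

Definition isometry_iso : lattice_iso :=
  @LatticeIso tau tau'
    (fun e => exist (fun f => is_true (is_edge f)) _ (is_edge_imfset e tauE))
    (fun e => exist (fun f => is_true (is_edge f)) _ (is_edge_imfset e tau'E))
    tauK tau'K (fun=> erefl) (fun=> erefl).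

End isometry.

Definition col_perm_iso (s : 'S_d) : lattice_iso.
Proof.
apply: (@isometry_iso (col_perm s) (col_perm s^-1)).
- by move=> x; rewrite -col_permM mulVg col_perm1.
- by move=> x; rewrite -col_permM mulgV col_perm1.
- move=> x y; rewrite [RHS](reindex_inj (@perm_inj _ s)).
  by apply: eq_bigr => i _; rewrite !mxE.
Defined.

Lemma reflect_coordK (i : 'I_d) : involutive (reflect_coord i).
Proof.
by move=> x; apply/rowP => j; rewrite !mxE; case: eqP => // _; rewrite opprK.
Qed.

Definition reflect_iso (i : 'I_d) : lattice_iso.
Proof.
apply: (isometry_iso (reflect_coordK i) (reflect_coordK i)) => x y.
apply: eq_bigr => j _; rewrite !mxE; case: ifP => // _.
by rewrite -opprD sqrrN.
Defined.

Lemma walk_iso (s : lattice_iso) x g y :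
  walk x g y -> walk (s x) (map (iso_edge s) g) (s y).
Proof.
elim: g x => [x <- //|e g IH x [z ez zy]] /=; exists (s z); last exact: IH.
by rewrite val_iso_edge ez imfset_fset2.
Qed.

Lemma walk_cat x y z g h : walk x g y -> walk y h z -> walk x (g ++ h) z.
Proof.
by elim: g x => [x -> //|e g IH x [x' ex x'y]] yz /=; exists x' => //; exact: IH.
Qed.

Lemma walk_rev x g y : walk x g y -> walk y (rev g) x.
Proof.
elim: g x => [x -> //|e g IH x [z ez zy]]; rewrite rev_cons -cats1.
by apply: walk_cat (IH _ zy) _ => /=; exists x => //; rewrite ez fsetUC.
Qed.

Lemma open_walk_iso (s : lattice_iso) w x g y : open_walk (pull (iso_edge s) w) x g y ->
  open_walk w (s x) (map (iso_edge s) g) (s y).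
Proof.
move=> [xgy og]; split; first exact: walk_iso.
by move=> _ /mapP[e eg ->]; exact: og.
Qed.

Lemma pull_iso_inv d' (T : measurableType d') (s : lattice_iso)
    (w : product_space (edge d) T) :
  pull (iso_edge_inv s) (pull (iso_edge s) w) = w.
Proof. by apply/funext => e; rewrite /pull iso_edge_invK. Qed.

Lemma linked_iso (s : lattice_iso) w x y :
  linked (pull (iso_edge s) w) x y <-> linked w (s x) (s y).
Proof.
split=> [[g xgy]|[g]]; first by exists (map (iso_edge s) g); exact: open_walk_iso.
rewrite -{1}(pull_iso_inv s w) => /(@open_walk_iso (iso_sym s)) /=.
by rewrite !isoK; exists (map (iso_edge_inv s) g).
Qed.

Lemma Cinf_iso (s : lattice_iso) w x : Cinf (pull (iso_edge s) w) x <-> Cinf w (s x).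
Proof.
rewrite /Cinf/= (_ : [set y | linked w (s x) y] =
    s @` [set y | linked (pull (iso_edge s) w) x y]).
  split=> inf; first by apply: contra_not inf => /(finite_image (iso_inv s)) H;
    apply: sub_finite_set H => y xy; exists (s y); rewrite ?isoK//; exists y.
  by apply: contra_not inf => /(finite_image s).
apply/seteqP; split=> [y xy|_ [y /linked_iso xy <-]//].
by exists (iso_inv s y); rewrite ?iso_invK//; apply/linked_iso; rewrite iso_invK.
Qed.

End lattice_isomorphisms.

(** * Travel times and their measurability *)

Section travel_time.
Context {R : realType} {d : nat}.
Implicit Types (x y z u : 'rV[int]_d) (e : edge d) (g h : seq (edge d)).
Implicit Types (w : Omega_E d) (eta : Omega_S R d).

Definition cost eta g : R := \sum_(e <- g) (eta e)%:num.

(** The infimum over walks need not be attained, but a strict upper bound is always witnessed by one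
    walk; upper bounds on travel times are therefore handled in strict form. *)
Lemma travel_time_ltP w eta x y (c : \bar R) : (travel_time w eta x y < c)%E <->
  exists2 g, open_walk w x g y & ((cost eta g)%:E < c)%E.
Proof.
split=> [/ereal_inf_lt[_ [g xgy <-] gc]|[g xgy gc]]; first by exists g.
by apply: le_lt_trans gc; apply: ereal_inf_lbound; exists g.
Qed.

Lemma travel_time_iso (s : lattice_iso d) w eta x y :
  travel_time (pull (iso_edge s) w) (pull (iso_edge s) eta) x y =
  travel_time w eta (s x) (s y).
Proof.
have cost_iso s' eta' g : cost (pull (iso_edge s') eta') g = cost eta' (map (iso_edge s') g).
  by rewrite /cost big_map.
have le_iso s' w' eta' x' y' :
    (travel_time w' eta' (iso s' x') (s' y') <=
     travel_time (pull (iso_edge s') w') (pull (iso_edge s') eta') x' y')%E.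
  apply: le_ereal_inf_tmp => _ [g xgy <-]; apply: ereal_inf_lbound.
  exists (map (iso_edge s') g); first exact: open_walk_iso.
  by rewrite -/(cost _ _) -cost_iso.
apply/eqP; rewrite eq_le le_iso andbT.
have := le_iso (iso_sym s) (pull (iso_edge s) w) (pull (iso_edge s) eta) (s x) (s y).
by rewrite /= !isoK !pull_iso_inv.
Qed.

Lemma travel_time_sym w eta x y : travel_time w eta x y = travel_time w eta y x.
Proof.
have le_sym x' y' : (travel_time w eta x' y' <= travel_time w eta y' x')%E.
  apply: le_ereal_inf_tmp => _ [g [ygx og] <-]; apply: ereal_inf_lbound.
  exists (rev g); last by rewrite (perm_big g)// perm_rev.
  by split=> [|e]; [exact: walk_rev|rewrite mem_rev; exact: og].
by apply/eqP; rewrite eq_le !le_sym.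
Qed.

Lemma travel_time_triangle w eta x y z (a b : R) :
  (travel_time w eta x y < a%:E)%E -> (travel_time w eta y z < b%:E)%E ->
  (travel_time w eta x z < (a + b)%:E)%E.
Proof.
move=> /travel_time_ltP[g [xgy og] ga] /travel_time_ltP[h [yhz oh] hb].
apply/travel_time_ltP; exists (g ++ h).
  split; first exact: walk_cat xgy yhz.
  by move=> e; rewrite mem_cat => /orP[/og|/oh].
by move: ga hb; rewrite !lte_fin /cost big_cat; exact: ltrD.
Qed.

Lemma measurable_open_walk x g y : measurable [set w | open_walk w x g y].
Proof.
have [xgy|nxgy] := pselect (walk x g y); last first.
  rewrite (_ : [set w | _] = set0) ?measurable0//.
  by apply/seteqP; split => // w [].
rewrite (_ : [set w | _] = rect [fset e in g]%fset (fun=> [set b | is_true b])).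
  exact: measurable_rect.
apply/seteqP; split=> w /=.
  by move=> [_ og] e; rewrite inE; exact: og.
by move=> wg; split=> // e eg; apply: wg; rewrite inE.
Qed.

Lemma measurable_passage_time e : measurable_fun setT (fun eta => (eta e)%:num : R).
Proof.
move=> _ B mB; rewrite setTI.
apply: (@measurable_cylinder _ _ (nnreal R) e [set x | B x%:num]).
by exists B => //; rewrite setTI.
Qed.

Lemma measurable_cost g : measurable_fun setT (cost ^~ g).
Proof. by apply: measurable_sum => e; exact: measurable_passage_time. Qed.

Definition fast x y (c : R) : set (Omega_E d * Omega_S R d) :=
  [set we | (travel_time we.1 we.2 x y < c%:E)%E].

(** There are countably many walks, and for each one openness concerns the first factor and cost the
    second. *)
Lemma measurable_fast x y c : measurable (fast x y c).
Proof.
rewrite (_ : fast x y c = \bigcup_(g : seq (edge d))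
    ([set w | open_walk w x g y] `*` (setT `&` (cost ^~ g) @^-1` `]-oo, c[%classic))).
  apply: countable_bigcupT_measurable => [|g]; first exact: countableP.
  by apply: measurableX; [exact: measurable_open_walk|exact: measurable_cost].
apply/seteqP; split=> [[w eta] /travel_time_ltP[g xgy gc]|[w eta] [g _ [/= xgy [_ gc]]]].
  by exists g => //; split=> //; split=> //=; rewrite in_itv.
by apply/travel_time_ltP; exists g => //; move: gc; rewrite in_itv.
Qed.

(** Walk lengths are integers: if all exceed r >= 0, they are at least [(Num.truncn r).+1], so the
    infimum still exceeds r strictly. *)
Lemma gt_chemical_distanceP w x y (r : R) : ((r%:E < chemical_distance R w x y)%E) <->
  (forall g, open_walk w x g y -> r < (size g)%:R).
Proof.
split=> [rD g xgy|H].
  rewrite -lte_fin (lt_le_trans rD)//; apply: ereal_inf_lbound.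
  by exists g.
have [r0|r0] := ltP r 0.
  apply: (@lt_le_trans _ _ 0%E); first by rewrite lte_fin.
  by apply: le_ereal_inf_tmp => _ [g _ <-]; rewrite lee_fin.
apply: (@lt_le_trans _ _ (Num.truncn r).+1%:R%:E); first by rewrite lte_fin truncnS_gt.
apply: le_ereal_inf_tmp => _ [g /H rg <-]; rewrite lee_fin ler_nat.
by rewrite -(ltr_nat R) (le_lt_trans _ rg)// truncn_le.
Qed.

End travel_time.

(** * Density of the infinite clusters *)

Section percolation_shifts.
Context {R : realType} {d : nat}.
Implicit Types (x y z u v : 'rV[int]_d) (e : edge d) (w : Omega_E d).

Lemma theta_gt0 (p : R) (Pp : probability (Omega_E d) R) :
  critical_probability R d < p -> p <= 1 -> iid_law (bernoulli_prob p) Pp ->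
  0 < prob Pp (percolates 0).
Proof.
rewrite /critical_probability; set E := [set q | _] => pc p1 PpE.
have E1 : ubound E 1 by move=> q [/andP[]].
have supE q : E q -> q <= sup E.
  by move=> Eq; apply: ub_le_sup => //; exists 1.
(* When the set defining the critical probability is empty, its [sup] is 0 by convention, and p is
   still positive. *)
have p0 : 0 <= p.
  have [E0|/set0P[q Eq]] := eqVneq E set0; first by rewrite ltW// -(@sup0 R) -E0.
  by rewrite (le_trans _ (ltW pc))// (le_trans _ (supE _ Eq))//; have [/andP[]] := Eq.
rewrite lt_neqAle prob_ge0 andbT eq_sym; apply/eqP => P0.
have /supE : E p.
  split; first by rewrite p0 p1.
  exists Pp => //; rewrite probE ?P0//; exact: measurable_percolates.
by rewrite leNgt pc.
Qed.

Lemma shift_edgeD u v e : shift_edge u (shift_edge v e) = shift_edge (v + u) e.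
Proof.
apply: val_inj => /=; apply/fsetP => x; apply/imfsetP/imfsetP.
  by move=> [_ /imfsetP[y /= ye ->] ->]; exists y => //; rewrite addrA.
move=> [y /= ye ->]; exists (y + v); last by rewrite addrA.
by apply/imfsetP; exists y.
Qed.

Lemma shift_edge0 e : shift_edge 0 e = e.
Proof.
apply: val_inj => /=; apply/fsetP => x; apply/imfsetP/idP => [[y /= ye ->]|xe].
  by rewrite addr0.
by exists x => //; rewrite addr0.
Qed.

Lemma shift_edgeK u : cancel (shift_edge u) (shift_edge (- u)).
Proof. by move=> e; rewrite shift_edgeD subrr shift_edge0. Qed.

Lemma card_edge e : #|` val e| = 2%N.
Proof.
case: e => e /= /asboolP[x [y [-> xy]]]; rewrite cardfs2; case: eqP => // E.
by move: xy; rewrite E big1// => i _; rewrite subrr expr0n.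
Qed.

(* The sum of the two endpoints of a translate of e moves linearly with the
   translation. *)
Lemma shift_edge_separated u v e f : u != v ->
  \forall n \near \oo, shift_edge (u *+ n) e != shift_edge (v *+ n) f.
Proof.
move=> uv; have [i ui] : exists i, u 0 i != v 0 i.
  apply/existsP; apply: contraNT uv => /existsPn H.
  by apply/eqP/rowP => i; apply/eqP; move/(_ i): H; rewrite negbK.
pose s (a : {fset 'rV[int]_d}) : int := \sum_(x <- a) x 0 i.
have sE x a : s (val (shift_edge x a)) = s (val a) + x 0 i *+ 2.
  rewrite /s big_imfset/=; last by move=> y z _ _; exact: addIr.
  under eq_bigr do rewrite mxE.
  by rewrite big_split/= big_const_seq count_predT -(card_edge a) iter_addr_0.
near=> n; apply/eqP => /(congr1 (s \o val)) /=; rewrite !sE => E.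
have {}E : (u 0 i - v 0 i) *+ n *+ 2 = s (val f) - s (val e).
  move: E => /(canRL (addKr _)); rewrite !mulmxnE !mulrnBl => ->.
  by rewrite addrA addrK addrC.
(* The left side of E is 2 n times a nonzero integer, so it cannot equal a fixed integer of absolute
   value below n. *)
have n_large : (`|s (val f) - s (val e)| < n)%N by near: n; exact: nbhs_infty_gt.
have c0 : u 0 i - v 0 i != 0 by rewrite subr_eq0.
move: n_large; rewrite -E -[_ *+ 2]mulr_natr -[_ *+ n]mulr_natr !abszM !natz !absz_nat.
by rewrite ltnNge mulnAC leq_pmull// muln_gt0 absz_gt0 c0.
Unshelve. all: by end_near. Qed.

Lemma pull_shift_percolates x y :
  pull (shift_edge x) @^-1` percolates y = percolates (y + x).
Proof. by apply/seteqP; split=> w /=; rewrite /percolates /= (Cinf_iso (shift_iso x)). Qed.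

End percolation_shifts.

Section density.
Context {R : realType} {d : nat}.
Implicit Types (x y z u v : 'rV[int]_d) (w : Omega_E d).
Variables (nu : probability bool R) (Pp : probability (Omega_E d) R).
Hypothesis PpE : iid_law nu Pp.
Notation theta := (prob Pp (percolates 0)).

Lemma Pp_pull_shift u X : measurable X -> Pp (pull (shift_edge u) @^-1` X) = Pp X.
Proof. by move=> mX; rewrite (iid_pull PpE (shift_edgeK u)). Qed.

Lemma shift_mixing u v A B C : u != 0 -> v != 0 -> u != v ->
  measurable A -> measurable B -> measurable C ->
  prob Pp (A `&` pull (shift_edge (u *+ n)) @^-1` B
             `&` pull (shift_edge (v *+ n)) @^-1` C)
    @[n --> \oo] --> prob Pp A * prob Pp B * prob Pp C.
Proof.
move=> u0 v0 uv mA mB mC.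
have := @iid_mixing _ _ _ _ nu Pp PpE (fun n => shift_edge (0 *+ n))
  (fun n => shift_edge (u *+ n)) (fun n => shift_edge (v *+ n))
  _ _ _ A B C (fun n => shift_edgeK _) (fun n => shift_edgeK _) (fun n => shift_edgeK _)
  _ _ _ mA mB mC.
have A0 : pull (shift_edge 0) @^-1` A = A.
  by apply/seteqP; split=> w; rewrite /= (_ : pull _ w = w)//;
    apply/funext => e; rewrite /pull shift_edge0.
under eq_fun do rewrite mul0rn A0.
by apply=> e f; apply: shift_edge_separated => //; rewrite eq_sym.
Qed.

Lemma percolates_mixing u v : u != 0 -> v != 0 -> u != v ->
  prob Pp (percolates 0 `&` percolates (u *+ n) `&` percolates (v *+ n))
    @[n --> \oo] --> theta ^+ 3.
Proof.
move=> u0 v0 uv; have m0 := measurable_percolates (0 : 'rV[int]_d).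
have := shift_mixing u0 v0 uv m0 m0 m0.
under eq_fun do rewrite !pull_shift_percolates !add0r.
by rewrite !exprS expr0 mulr1 mulrA.
Qed.

(** Since mixing is stated for two distinct nonzero vectors, u and 2 u serve when a single direction
    is at stake. *)
Lemma double_neq u : u != 0 -> (u *+ 2 != 0) && (u != u *+ 2).
Proof.
move=> u0; apply/andP; split; last first.
  by rewrite mulr2n -subr_eq0 opprD addrA subrr sub0r oppr_eq0.
apply: contraNneq u0 => /rowP H; apply/eqP/rowP => i; have /eqP := H i.
by rewrite !mxE -mulr2n mulrn_eq0 => /eqP.
Qed.

Lemma iter_pull_shift u n w :
  iter n (pull (shift_edge u)) w = pull (shift_edge (u *+ n)) w.
Proof.
elim: n w => [|n IH] w; apply/funext => e.
  by rewrite /pull mulr0n shift_edge0.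
by rewrite iterSr IH /pull shift_edgeD -mulrSr.
Qed.

(** Mixing applied to X, X and the whole space gives P X = (P X) ^ 2 for an invariant X. *)
Lemma shift_ergodic u X : u != 0 -> measurable X ->
  pull (shift_edge u) @^-1` X = X -> Pp X = 0%E \/ Pp X = 1%E.
Proof.
move=> u0 mX XE; have /andP[u20 uu2] := double_neq u0.
have XnE n : pull (shift_edge (u *+ n)) @^-1` X = X.
  elim: n => [|n IH].
    by rewrite -[RHS]/(iter 0 (pull (shift_edge u)) @^-1` X); apply/funext => w;
      rewrite /= -iter_pull_shift.
  rewrite -[RHS]IH -[in RHS]XE; apply/funext => w /=.
  by rewrite -!iter_pull_shift -iterS iterSr.
have := shift_mixing u0 u20 uu2 mX mX (@measurableT _ _).
under eq_fun do rewrite preimage_setT setIT XnE setIid.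
rewrite probT mulr1 => /cvg_lim -/(_ (@Rhausdorff _)); rewrite lim_cst// => E.
have /eqP : prob Pp X * (1 - prob Pp X) = 0 by rewrite mulrBr mulr1 -E subrr.
rewrite mulf_eq0 => /orP[/eqP P0|]; first by left; rewrite probE// P0.
by rewrite subr_eq0 => /eqP P1; right; rewrite probE// -P1.
Qed.

Definition count_perc u w k := (\sum_(1 <= j < k.+1 | `[< Cinf w (u *+ j) >]) 1)%N.

Lemma count_perc0 u w : count_perc u w 0 = 0%N.
Proof. by rewrite /count_perc big_geq. Qed.

Lemma count_percS u w k :
  count_perc u w k.+1 = (count_perc u w k + `[< Cinf w (u *+ k.+1) >])%N.
Proof. by rewrite /count_perc big_mkcond big_nat_recr//= -big_mkcond; case: asboolP. Qed.

(** Multiples are counted from j = 1 whereas [visits] starts at j = 0, hence the orbit of the once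
    shifted configuration. *)
Lemma count_perc_visits u w k : (count_perc u w k)%:R =
  visits (pull (shift_edge u)) (percolates 0) k (pull (shift_edge u) w) :> R.
Proof.
elim: k => [|k IH]; first by rewrite count_perc0 /visits big_geq.
rewrite count_percS natrD IH -[k.+1]addn1 [RHS]visitsD visits1; congr (_ + _).
rewrite -iterSr iter_pull_shift indicE; congr (_%:R).
have -> : (pull (shift_edge (u *+ k.+1)) w \in percolates 0) =
    (w \in pull (shift_edge (u *+ k.+1)) @^-1` percolates 0) by [].
by rewrite pull_shift_percolates add0r addn1; apply/asboolP/idP; rewrite inE.
Qed.

Lemma count_perc_cvg u : u != 0 ->
  {ae Pp, forall w, (count_perc u w k)%:R / k%:R @[k --> \oo] --> theta}.
Proof.
move=> u0.
have [N [mN N0 badN]] := ae_cvg_visits (P := Pp) (measurable_pull (shift_edge u))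
  (@Pp_pull_shift u) (fun X mX XE => shift_ergodic u0 mX XE)
  (measurable_percolates (0 : 'rV[int]_d)).
(* The orbit starts one shift later, so the exceptional set is pulled back, which keeps it null by
   invariance. *)
exists (pull (shift_edge u) @^-1` N); split.
- exact: measurable_pull_preimage.
- by rewrite Pp_pull_shift.
- move=> w /= H; apply: badN => /= H'; apply: H.
  by under eq_fun do rewrite count_perc_visits.
Qed.

Lemma count_perc_le u w j k : (j <= k)%N -> (count_perc u w j <= count_perc u w k)%N.
Proof.
move=> /subnKC <-; elim: (k - j)%N => [|n IH]; first by rewrite addn0.
by rewrite addnS count_percS (leq_trans IH)// leq_addr.
Qed.

Lemma count_perc_leq u w k : (count_perc u w k <= k)%N.
Proof.
elim: k => [|k IH]; first by rewrite count_perc0.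
by rewrite count_percS -[leqRHS]addn1 leq_add// leq_b1.
Qed.

Definition perc_time u w n : set nat :=
  [set k | [/\ (1 <= k)%N, Cinf w (u *+ k) & count_perc u w k = n]].

(** The count strictly increases at each visit, so it takes a given value at one visit only. *)
Lemma perc_time_inj u w n j k : perc_time u w n j -> perc_time u w n k -> j = k.
Proof.
suff ltF i l : (i < l)%N -> perc_time u w n i -> perc_time u w n l -> False.
  by move=> H H'; have [/ltF/(_ H H')|/ltF/(_ H' H)|//] := ltngtP j k.
case: l => // l; rewrite ltnS => /(count_perc_le u w) il [_ _ iE] [_ Cl].
move: il; rewrite iE count_percS => il lE; move: il; rewrite -lE.
by move/asboolP : Cl => ->; rewrite addn1 ltnn.
Qed.

Lemma T_perc_time u w n k : perc_time u w n k -> T_ w n u = k.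
Proof. by move=> uk; apply: xget_subset1 => // i j; exact: perc_time_inj. Qed.

(** The n-th visit is the least k at which the count reaches n: minimality forces k u into [Cinf]
    and the count to be exactly n. *)
Lemma perc_time_T u w n k : (0 < n <= count_perc u w k)%N ->
  perc_time u w n (T_ w n u).
Proof.
move=> /andP[n0 nk].
suff [j uj] : perc_time u w n !=set0 by rewrite (T_perc_time uj).
have ex : exists k, (n <= count_perc u w k)%N by exists k.
case: (ex_minnP ex) => -[|j]; first by rewrite count_perc0 leqNgt n0.
move=> nj jmin; exists j.+1.
have nj' : (count_perc u w j < n)%N.
  by rewrite ltnNge; apply/negP => /jmin; rewrite ltnn.
move: nj; rewrite count_percS; case: asboolP => Cj; rewrite ?addn1 ?addn0 => nj.
  split=> //; rewrite count_percS; move/asboolP : Cj => ->; rewrite addn1.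
  by apply/eqP; rewrite eqn_leq nj nj'.
by move: nj; rewrite leqNgt nj'.
Qed.

End density.

(** * Speed in a direction *)

Section conditioning.
Context {R : realType} {d} {T : measurableType d}.
Variables (P : probability T R) (C : set T) (mC : measurable C).

(** A nonzero [P C] rules out the default value of [mnormalize]. *)
Lemma conditionedE (X : set T) : P C != 0%E -> measurable X ->
  conditioned P mC X = (P (X `&` C) * ((prob P C)^-1)%:E)%E.
Proof.
move=> C0 mX; rewrite /conditioned /= /mnormalize /=.
have -> : mrestr P mC setT = P C by rewrite /mrestr setTI.
by rewrite (negbTE C0)/= {1}probE.
Qed.

Lemma ae_conditioned (Q : T -> Prop) :
  P C != 0%E -> {ae P, forall x, Q x} -> {ae conditioned P mC, forall x, Q x}.
Proof.
move=> C0 [N [mN N0 QN]]; exists N; split=> //.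
rewrite conditionedE// (_ : P (N `&` C) = 0%E) ?mul0e//.
apply/eqP; rewrite -measure_le0 -N0; apply: le_measure; rewrite ?inE//.
exact: measurableI.
Qed.

End conditioning.

Section joint_law.
Context {R : realType} {d1 d2} {T1 : measurableType d1} {T2 : measurableType d2}.
Variables (P : probability T1 R) (S : probability T2 R).

Definition joint : probability (T1 * T2)%type R := (P \x S)%E.

Lemma joint_setX A B : measurable A -> measurable B -> joint (A `*` B) = (P A * S B)%E.
Proof. exact: product_measure1E. Qed.

Lemma joint_setXT A : measurable A -> joint (A `*` setT) = P A.
Proof. by move=> mA; rewrite joint_setX// probability_setT mule1. Qed.

Lemma ae_joint1 (Q : T1 -> Prop) :
  {ae P, forall x, Q x} -> {ae (P \x S)%E, forall x : T1 * T2, Q x.1}.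
Proof.
move=> [N [mN N0 QN]]; exists (N `*` setT); split.
- exact: measurableX.
- by rewrite [LHS]joint_setXT.
- by move=> x /= Qx; split=> //; exact: QN.
Qed.

End joint_law.

Section conditioned_joint_law.
Context {R : realType} {d1 d2} {T1 : measurableType d1} {T2 : measurableType d2}.
Variables (P : probability T1 R) (S : probability T2 R).
Variables (C : set T1) (mC : measurable C).

(** Conditioning the first factor commutes with taking the product, since both laws agree on
    rectangles. This converts statements under [Pbar] into statements under the unconditioned joint
    law. *)
Lemma conditioned_joint (X : set (T1 * T2)) : P C != 0%E -> measurable X ->
  (conditioned P mC \x S)%E X =
  (joint P S (X `&` (C `*` setT)) * ((prob P C)^-1)%:E)%E.
Proof.
move=> C0 mX; have mCT : measurable (C `*` [set: T2]) by exact: measurableX.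
have JC : joint P S (C `*` setT) = P C by exact: joint_setXT.
transitivity (conditioned (joint P S) mCT X); last first.
  by rewrite conditionedE ?JC// /prob JC.
apply: (product_measure_unique (m' := conditioned (joint P S) mCT)) => // A B mA mB.
transitivity (conditioned (joint P S) mCT (A `*` B)); first by [].
rewrite !conditionedE ?JC//; last exact: measurableX.
rewrite -setXI setIT joint_setX//; last exact: measurableI.
rewrite [X in _ = (X * _)%E](_ : _ = conditioned P mC A)// conditionedE//.
by rewrite muleAC /prob JC.
Qed.

End conditioned_joint_law.

Section joint_pull.
Context {R : realType} {d : nat}.
Implicit Types (s : edge d -> edge d).

Definition pull2 s (we : Omega_E d * Omega_S R d) : Omega_E d * Omega_S R d :=
  (pull s we.1, pull s we.2).

Lemma measurable_pull2 s : measurable_fun setT (pull2 s).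
Proof.
apply: measurable_fun_pair; apply: measurableT_comp.
- exact: measurable_pull.
- exact: measurable_fst.
- exact: measurable_pull.
- exact: measurable_snd.
Qed.

HB.instance Definition _ s :=
  isMeasurableFun.Build _ _ _ _ (pull2 s) (measurable_pull2 s).

Lemma joint_pull2 (P : probability (Omega_E d) R) (S : probability (Omega_S R d) R) s :
  (forall X, measurable X -> P (pull s @^-1` X) = P X) ->
  (forall X, measurable X -> S (pull s @^-1` X) = S X) ->
  forall X, measurable X -> joint P S (pull2 s @^-1` X) = joint P S X.
Proof.
move=> Ps Ss X mX; apply/esym.
apply: (product_measure_unique (m' := distribution (joint P S) (pull2 s))) => //.
move=> A B mA mB.
rewrite [LHS](_ : _ = joint P S ((pull s @^-1` A) `*` (pull s @^-1` B)))//.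
by rewrite joint_setX ?Ps ?Ss//; exact: measurable_pull_preimage.
Qed.

End joint_pull.

(** * Convergence in probability along a direction *)

Section directional_speed.
Context {R : realType} {d : nat}.
Variables (nu : probability bool R) (Pp : probability (Omega_E d) R).
Variable S : probability (Omega_S R d) R.
Hypotheses (PpE : iid_law nu Pp) (S_stationary : stationary S).
Notation theta := (prob Pp (percolates 0)).
Notation M := (joint Pp S).
Hypothesis theta0 : 0 < theta.
Implicit Types (x y z u v : 'rV[int]_d) (a b c eps : R).
Implicit Types (we : Omega_E d * Omega_S R d).

Definition perc2 x : set (Omega_E d * Omega_S R d) := percolates x `*` setT.

Lemma measurable_perc2 x : measurable (perc2 x).
Proof. by apply: measurableX => //; exact: measurable_percolates. Qed.

(** The window for the travel time is written as a difference of two [fast] events; an infinite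
    travel time between points of [Cinf] counts as bad. *)
Definition bad n x y a eps : set (Omega_E d * Omega_S R d) :=
  perc2 x `&` perc2 y `&`
  ~` (fast x y (n%:R * (a + eps)) `\` fast x y (n%:R * (a - eps))).

Lemma measurable_bad n x y a eps : measurable (bad n x y a eps).
Proof.
apply: measurableI; first by apply: measurableI; exact: measurable_perc2.
by apply: measurableC; apply: measurableD; exact: measurable_fast.
Qed.

Lemma not_bad n x y a eps we : perc2 x we -> perc2 y we -> ~ bad n x y a eps we ->
  ((n%:R * (a - eps))%:E <= travel_time we.1 we.2 x y < (n%:R * (a + eps))%:E)%E.
Proof.
move=> xwe ywe nbad; have [fa nfa] : (fast x y (n%:R * (a + eps)) `\`
    fast x y (n%:R * (a - eps))) we by apply: contrapT => H; exact: nbad.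
by apply/andP; split => //; rewrite leNgt; apply/negP.
Qed.

Lemma bad_sym n x y a eps : bad n x y a eps = bad n y x a eps.
Proof.
rewrite /bad [perc2 x `&` _]setIC; congr (_ `&` ~` (_ `\` _));
by apply/funext => we; rewrite /fast /= travel_time_sym.
Qed.

Lemma pull2_bad (s : lattice_iso d) n x y a eps :
  pull2 (iso_edge s) @^-1` bad n x y a eps = bad n (s x) (s y) a eps.
Proof.
have perc2E z : pull2 (iso_edge s) @^-1` perc2 z = perc2 (s z).
  by apply/seteqP; split=> we [H _]; split=> //; apply/(Cinf_iso s).
have fastE c : pull2 (iso_edge s) @^-1` fast x y c = fast (s x) (s y) c.
  by apply/funext => we; rewrite /fast /= travel_time_iso.
by rewrite /bad !setDE 2!preimage_setI !perc2E -preimage_setC preimage_setI -preimage_setC !fastE.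
Qed.

(* Convergence in probability of d(0, n u) / n to a on {0, n u \in Cinf}: unlike
   the almost sure convergence along T_, it is stated at deterministic points and
   under the unconditioned law, hence can be transported by lattice isomorphisms. *)
Definition has_speed u a := forall eps, 0 < eps ->
  prob M (bad n 0 (u *+ n) a eps) @[n --> \oo] --> (0 : R).

Lemma M_pull_shift u X : measurable X -> M (pull2 (shift_edge u) @^-1` X) = M X.
Proof.
apply: joint_pull2 => {}X mX; first exact: Pp_pull_shift PpE _ _ mX.
(* [translate u] and [pull (shift_edge u)] are the same map by definition. *)
exact: S_stationary.
Qed.

Lemma prob_bad_shift n x y z a eps :
  prob M (bad n (x + z) (y + z) a eps) = prob M (bad n x y a eps).
Proof.
rewrite -(pull2_bad (shift_iso z)) /prob M_pull_shift//; exact: measurable_bad.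
Qed.

Lemma cvg_prob0_setU (A B : (set (Omega_E d * Omega_S R d))^nat) :
  (forall n, measurable (A n)) -> (forall n, measurable (B n)) ->
  prob M (A n) @[n --> \oo] --> (0 : R) -> prob M (B n) @[n --> \oo] --> (0 : R) ->
  prob M (A n `|` B n) @[n --> \oo] --> (0 : R).
Proof.
move=> mA mB A0 B0; apply: (squeeze_cvgr (f := fun=> 0)
    (h := fun n => prob M (A n) + prob M (B n))).
- by apply: nearW => n; rewrite prob_ge0 le_probU.
- exact: cvg_cst.
- by rewrite -[0]addr0; exact: cvgD.
Qed.

(** Events of probability tending to 0 cannot cover the event that all three points percolate, whose
    probability tends to [theta ^+ 3]. The configuration obtained lets inequalities between travel
    times pass to speeds. *)
Lemma exists_perc_triple u v (B : (set (Omega_E d * Omega_S R d))^nat) :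
  u != 0 -> v != 0 -> u != v ->
  (forall n, measurable (B n)) -> prob M (B n) @[n --> \oo] --> (0 : R) ->
  exists n we, [/\ (0 < n)%N, perc2 0 we, perc2 (u *+ n) we, perc2 (v *+ n) we &
    ~ B n we].
Proof.
move=> u0 v0 uv mB B0.
pose A n := percolates 0 `&` percolates (u *+ n) `&` percolates (v *+ n).
have mA n : measurable (A n).
  by do 2?[apply: measurableI]; exact: measurable_percolates.
have t3 : 0 < theta ^+ 3 / 2 by rewrite divr_gt0// exprn_gt0.
have /cvgrPdist_lt/(_ _ t3) nearA := percolates_mixing PpE u0 v0 uv.
move/cvgrPdist_lt/(_ _ t3): B0 => nearB.
near \oo => n.
have An : `|theta ^+ 3 - prob Pp (A n)| < theta ^+ 3 / 2 by near: n.
have Bn : `|0 - prob M (B n)| < theta ^+ 3 / 2 by near: n.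
have n0 : (0 < n)%N by near: n; exact: nbhs_infty_gt.
have AE : prob Pp (A n) = prob M (A n `*` setT) by rewrite /prob joint_setXT.
have mA2 : measurable (A n `*` [set: Omega_S R d]) by exact: measurableX.
suff [we [[[[p0 pu] pv] _] nB]] : (A n `*` setT `\` B n) !=set0.
  by exists n, we; split.
apply/set0P/eqP => E; have AB : A n `*` setT `<=` B n by rewrite -setD_eq0.
have := le_prob M mA2 (mB n) AB; rewrite -AE.
move: An Bn; rewrite !ltr_norml => /andP[_ An] /andP[Bn _]; lra.
Unshelve. all: by end_near. Qed.

Lemma has_speed_unique u a b : u != 0 -> has_speed u a -> has_speed u b -> a = b.
Proof.
move=> u0 ua ub; apply/eqP/negP => /negP ab.
(* With half the gap as tolerance, the windows around a and b are disjoint. *)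
pose eps := `|a - b| / 2; have eps0 : 0 < eps by rewrite divr_gt0// normr_gt0 subr_eq0.
have /andP[u20 uu2] := double_neq u0.
have [n [we [n0 p0 pu _ /not_orP[/not_bad na /not_bad nb]]]] := exists_perc_triple u0 u20 uu2
  (fun n => measurableU _ _ (measurable_bad n 0 (u *+ n) a eps) (measurable_bad n 0 (u *+ n) b eps))
  (cvg_prob0_setU (fun n => measurable_bad n 0 (u *+ n) a eps)
    (fun n => measurable_bad n 0 (u *+ n) b eps) (ua _ eps0) (ub _ eps0)).
have /andP[a1 a2] := na p0 pu; have /andP[b1 b2] := nb p0 pu.
have n0' : 0 < n%:R :> R by rewrite ltr0n.
have := le_lt_trans a1 b2; rewrite lte_fin ltr_pM2l// => h1.
have := le_lt_trans b1 a2; rewrite lte_fin ltr_pM2l// => h2.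
have : `|a - b| < 2 * eps by rewrite ltr_norml; apply/andP; split; lra.
by rewrite /eps mulrC divfK// ltxx.
Qed.

Lemma has_speed_iso (s : lattice_iso d) u a :
  (forall n, s (u *+ n) = s u *+ n) ->
  (forall X, measurable X -> M (pull2 (iso_edge s) @^-1` X) = M X) ->
  has_speed u a -> has_speed (s u) a.
Proof.
move=> sM Ms ua eps eps0.
have s0 : s 0 = 0 by have := sM 0%N; rewrite !mulr0n.
have E n : prob M (bad n 0 (s u *+ n) a eps) = prob M (bad n 0 (u *+ n) a eps).
  by rewrite -sM -{1}s0 -pull2_bad /prob Ms//; exact: measurable_bad.
by under eq_fun do rewrite E; exact: ua.
Qed.

(** Reversing walks exchanges the endpoints, and a translation by n u moves the pair -n u, 0 to 0, n
    u. *)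
Lemma has_speed_opp u a : has_speed u a -> has_speed (- u) a.
Proof.
move=> ua eps eps0.
have E n : prob M (bad n 0 (- u *+ n) a eps) = prob M (bad n 0 (u *+ n) a eps).
  by rewrite bad_sym -(prob_bad_shift _ _ _ (u *+ n)) mulNrn addNr add0r.
by under eq_fun do rewrite E; exact: ua.
Qed.

(** The bad event for k u at scale n is the one for u at scale k n with tolerance eps / k, so the
    limit is taken along the multiples of k. *)
Lemma has_speed_mulrn u a k : (0 < k)%N -> has_speed u a ->
  has_speed (u *+ k) (k%:R * a).
Proof.
move=> k0 ua eps eps0; have k0' : 0 < k%:R :> R by rewrite ltr0n.
have ek : 0 < eps / k%:R by rewrite divr_gt0.
have ks : (k * n)%N @[n --> \oo] --> \oo.
  by apply/cvgnyPge => A; exists A => // n /= An; rewrite (leq_trans An)// leq_pmull.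
have E n : prob M (bad n 0 (u *+ k *+ n) (k%:R * a) eps) =
    prob M (bad (k * n) 0 (u *+ (k * n)) a (eps / k%:R)).
  rewrite -mulrnA /bad natrM.
  have -> : k%:R * n%:R * (a + eps / k%:R) = n%:R * (k%:R * a + eps).
    by field; rewrite gt_eqF.
  have -> : k%:R * n%:R * (a - eps / k%:R) = n%:R * (k%:R * a - eps).
    by field; rewrite gt_eqF.
  by [].
under eq_fun do rewrite E.
exact: (cvg_comp _ _ ks (ua _ ek)).
Qed.

(** The triangle inequality at 0, n u and n (u + v), all in [Cinf] and with all three travel times
    inside their windows, is divided by n. *)
Lemma has_speed_subadditive u v a b c : u != 0 -> v != 0 -> u + v != 0 ->
  has_speed u a -> has_speed v b -> has_speed (u + v) c -> c <= a + b.
Proof.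
move=> u0 v0 uv0 ua vb wc; apply/ler_addgt0Pr => e e0.
(* One tolerance for each of the three travel times. *)
pose eps := e / 3; have eps0 : 0 < eps by rewrite divr_gt0.
have uuv : u != u + v by rewrite -subr_eq0 opprD addrA subrr sub0r oppr_eq0.
pose B1 n := bad n 0 (u *+ n) a eps.
pose B2 n := bad n (u *+ n) ((u + v) *+ n) b eps.
pose B3 n := bad n 0 ((u + v) *+ n) c eps.
(* A translation by n u reduces the middle increment to the pair 0, n v. *)
have B20 : prob M (B2 n) @[n --> \oo] --> (0 : R).
  have E n : prob M (B2 n) = prob M (bad n 0 (v *+ n) b eps).
    by rewrite /B2 -(prob_bad_shift n 0 (v *+ n) (u *+ n)) add0r -mulrnDl addrC.
  by under eq_fun do rewrite E; exact: vb.
have mB1 n : measurable (B1 n) by exact: measurable_bad.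
have mB2 n : measurable (B2 n) by exact: measurable_bad.
have mB3 n : measurable (B3 n) by exact: measurable_bad.
have mB12 n : measurable (B1 n `|` B2 n) by exact: measurableU.
have [n [we [n0 p0 pu pw /not_orP[/not_orP[na nb] nc]]]] :=
  exists_perc_triple u0 uv0 uuv (fun n => measurableU _ _ (mB12 n) (mB3 n))
    (cvg_prob0_setU mB12 mB3 (cvg_prob0_setU mB1 mB2 (ua _ eps0) B20) (wc _ eps0)).
have /andP[_ a2] := not_bad p0 pu na; have /andP[_ b2] := not_bad pu pw nb.
have /andP[c1 _] := not_bad p0 pw nc.
have n0' : 0 < n%:R :> R by rewrite ltr0n.
have := le_lt_trans c1 (travel_time_triangle a2 b2).
rewrite lte_fin -mulrDr ltr_pM2l// /eps; lra.
Qed.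

End directional_speed.

(** * From visit times to deterministic multiples of u *)

Section speed_from_times.
Context {R : realType} {d : nat}.
Variables (u : 'rV[int]_d) (w : Omega_E d) (eta : Omega_S R d) (theta : R).
Hypothesis theta0 : 0 < theta.
Hypothesis count_cvg : (count_perc u w k)%:R / k%:R @[k --> \oo] --> theta.

Lemma count_perc_pinfty : count_perc u w k @[k --> \oo] --> \oo.
Proof.
apply/cvgnyPge => A; have t2 : 0 < theta / 2 by rewrite divr_gt0.
move/cvgrPdist_lt/(_ _ t2) : count_cvg => nearC.
near=> k.
have : `|theta - (count_perc u w k)%:R / k%:R| < theta / 2 by near: k.
have k0 : 0 < k%:R :> R by rewrite ltr0n; near: k; exact: nbhs_infty_gt.
rewrite ltr_norml => /andP[_ h].
have : theta / 2 < (count_perc u w k)%:R / k%:R by lra.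
rewrite ltr_pdivlMr// => h'.
have : A%:R / (theta / 2) < k%:R by near: k; exact: nbhs_infty_gtr.
rewrite ltr_pdivrMr// mulrC => h''.
by rewrite -(ler_nat R) ltW// (lt_trans h'').
Unshelve. all: by end_near. Qed.

Lemma perc_time_Tn n : (0 < n)%N -> perc_time u w n (T_ w n u).
Proof.
move=> n0; move/cvgnyPge/(_ n): count_perc_pinfty => [k _ /(_ k (leqnn k)) /= nk].
by apply: (@perc_time_T _ _ _ _ k); rewrite n0 nk.
Qed.

Lemma T_pinfty : T_ w n u @[n --> \oo] --> \oo.
Proof.
apply/cvgnyPge => A; exists A.+1 => // n /= An.
have [_ _ nE] := perc_time_Tn (leq_ltn_trans (leq0n _) An).
by rewrite (leq_trans (ltnW An))// -[X in (X <= _)%N]nE count_perc_leq.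
Qed.

(** The quotient by T_n is d / n times n / T_n; as n is the count at T_n, the second factor is the
    visit frequency taken along T_n, which tends to theta. *)
Lemma cvg_travel_time_T f :
  (travel_time w eta 0 (u *+ T_ w n u) * n%:R^-1%:E)%E @[n --> \oo] --> f%:E ->
  (travel_time w eta 0 (u *+ T_ w n u) * (T_ w n u)%:R^-1%:E)%E @[n --> \oo]
    --> (theta * f)%:E.
Proof.
move=> cf; have cT : (n%:R / (T_ w n u)%:R)%:E @[n --> \oo] --> theta%:E.
  apply: cvg_EFin; first by apply: nearW.
  have := cvg_comp _ _ T_pinfty count_cvg.
  apply: cvg_trans; apply: near_eq_cvg; exists 1%N => // n /= n0.
  by have [_ _ ->] := perc_time_Tn n0.
have fT : (f%:E *? theta%:E)%E by exact: mule_def_fin.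
have H : (travel_time w eta 0 (u *+ T_ w n u) * n%:R^-1%:E *
    (n%:R / (T_ w n u)%:R)%:E)%E @[n --> \oo] --> (theta * f)%:E.
  by rewrite mulrC EFinM; exact: cvgeM.
apply: cvg_trans H; apply: near_eq_cvg; exists 1%N => // n /= n0.
by rewrite -muleA -EFinM mulrA mulVf ?mul1r// pnatr_eq0 -lt0n.
Qed.

(** When k u lies in [Cinf], k is the n-th visit for n the count at k, which tends to infinity with
    k; when it does not, the event cannot be bad. *)
Lemma near_not_bad a eps : 0 < eps ->
  (travel_time w eta 0 (u *+ T_ w n u) * (T_ w n u)%:R^-1%:E)%E @[n --> \oo]
    --> a%:E ->
  \forall k \near \oo, ~ bad k 0 (u *+ k) a eps (w, eta).
Proof.
move=> eps0 /fine_cvgP[finT /cvgrPdist_lt/(_ _ eps0) cT].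
have cfin : nbhs \oo (count_perc u w @^-1` _) := count_perc_pinfty (filterI finT cT).
have k1 : \forall k \near \oo, (0 < k)%N by exact: nbhs_infty_gt.
apply: filterS2 k1 (cfin _) => k k0 /= [+ +] [[_ [/= Ck _]] nfast].
rewrite (@T_perc_time _ _ _ _ k)//; set D := travel_time _ _ _ _ => finD.
have k0' : 0 < k%:R :> R by rewrite ltr0n.
have ki : 0 < k%:R^-1 :> R by rewrite invr_gt0.
move: nfast; rewrite /fast /= -/D.
(* Finiteness of d / k forces that of d, since an infinite value is unchanged by a positive
   factor. *)
case: D finD => [D _| |]; rewrite ?gt0_mulye ?gt0_mulNye ?lte_fin//.
rewrite -EFinM /= ltr_norml => nfast /andP[h1 h2]; apply: nfast.
have h3 : D / k%:R < a + eps by lra.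
have h4 : a - eps < D / k%:R by lra.
move: h3 h4; rewrite ltr_pdivrMr// ltr_pdivlMr// => h3 h4.
split; first by rewrite mulrC.
by rewrite mulrC; apply/negP; rewrite -leNgt ltW.
Qed.

End speed_from_times.

Section speed.
Context {R : realType} {d : nat}.
Variables (nu : probability bool R) (Pp : probability (Omega_E d) R).
Variable S : probability (Omega_S R d) R.
Hypotheses (PpE : iid_law nu Pp) (S_stationary : stationary S).
Notation theta := (prob Pp (percolates 0)).
Notation M := (joint Pp S).
Hypothesis theta0 : 0 < theta.
Implicit Types (u : 'rV[int]_d) (a c f : R).

Lemma perc0_neq0 : Pp (percolates (0 : 'rV[int]_d)) != 0%E.
Proof. by rewrite probE ?eqe ?gt_eqF//; exact: measurable_percolates. Qed.

Lemma ae_Pbar1 (Q : Omega_E d -> Prop) : {ae Pp, forall w, Q w} ->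
  {ae Pbar Pp S, forall we, Q we.1}.
Proof.
move=> PQ; apply: ae_joint1.
by apply: ae_conditioned => //; exact: perc0_neq0.
Qed.

Lemma ae_cvg_travel_time_T u f : u != 0 ->
  {ae Pbar Pp S, forall we,
    (travel_time we.1 we.2 0 (u *+ T_ we.1 n u) * n%:R^-1%:E)%E
      @[n --> \oo] --> f%:E} ->
  {ae Pbar Pp S, forall we,
    (travel_time we.1 we.2 0 (u *+ T_ we.1 n u) * (T_ we.1 n u)%:R^-1%:E)%E
      @[n --> \oo] --> (theta * f)%:E}.
Proof.
move=> u0; apply: filterS2 (ae_Pbar1 (count_perc_cvg PpE u0)) => we cw.
exact: cvg_travel_time_T theta0 cw _.
Qed.

(** Almost surely only finitely many bad events occur; their tail unions decrease to a null set, so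
    their probabilities tend to 0. *)
Lemma cvg_has_speed u a : u != 0 ->
  {ae Pbar Pp S, forall we,
    (travel_time we.1 we.2 0 (u *+ T_ we.1 n u) * (T_ we.1 n u)%:R^-1%:E)%E
      @[n --> \oo] --> a%:E} -> has_speed Pp S u a.
Proof.
move=> u0 cvg_a eps eps0.
have : {ae Pbar Pp S, forall we, \forall k \near \oo, ~ bad k 0 (u *+ k) a eps we}.
  apply: filterS2 (ae_Pbar1 (count_perc_cvg PpE u0)) cvg_a => -[w eta] /= count_w.
  exact: near_not_bad theta0 count_w _ _ eps0.
move=> [N [mN N0 badN]].
pose B k := bad k 0 (u *+ k) a eps.
have mB k : measurable (B k) by exact: measurable_bad.
pose F n := \bigcup_(k in [set k | (n <= k)%N]) B k.
have mF n : measurable (F n) by apply: bigcup_measurable.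
have niF : nonincreasing_seq F.
  move=> n k nk; apply/subsetPset => we [l kl Bl]; exists l => //=.
  exact: leq_trans kl.
have mI : measurable (\bigcap_n F n) by exact: bigcapT_measurable.
have IN : \bigcap_n F n `<=` N.
  move=> we Fwe; apply: badN => /= -[n _ nB].
  by have [k /= nk] := Fwe n I; exact: nB.
have I0 : prob M (\bigcap_n F n) = 0.
  (* Every bad event requires 0 in [Cinf], so the limit set, null under [Pbar], is null under the
     joint law too. *)
  have IP : \bigcap_n F n `&` perc2 0 = \bigcap_n F n.
    by apply/setIidl => we /(_ 0%N I)[k _ [[]]].
  have : Pbar Pp S (\bigcap_n F n) = 0%E.
    apply/eqP; rewrite -measure_le0 -N0; apply: le_measure; rewrite ?inE//.
  rewrite /Pbar [LHS]conditioned_joint ?perc0_neq0// -/(perc2 0) IP probE//.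
  by rewrite -EFinM => -[/eqP]; rewrite mulf_eq0 invr_eq0 (gt_eqF theta0) orbF => /eqP.
have := nonincreasing_cvg_prob (P := M) mF niF; rewrite I0 => F0.
apply: (squeeze_cvgr (f := fun=> 0) (h := fun n => prob M (F n))) => //.
- apply: nearW => n; rewrite prob_ge0 /=.
  by apply: le_prob; [exact: mB|exact: mF|move=> we Bwe; exists n => /=].
- exact: cvg_cst.
Qed.

End speed.

(** * Upper bound on the speed through the chemical distance *)

Section speed_bound.
Context {R : realType} {d : nat}.
Variables (nu : probability bool R) (Pp : probability (Omega_E d) R).
Variable S : probability (Omega_S R d) R.
Hypothesis PpE : iid_law nu Pp.
Notation theta := (prob Pp (percolates 0)).
Notation M := (joint Pp S).
Hypothesis theta0 : 0 < theta.
Variable m : R.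
Hypothesis mean_le : forall e : edge d, (\int[S]_eta (eta e)%:num%:E <= m%:E)%E.
Hypothesis m0 : 0 <= m.
Implicit Types (u x y : 'rV[int]_d) (a c : R) (w : Omega_E d) (g : seq (edge d)).

Lemma integral_cost_le g : (\int[S]_eta (cost eta g)%:E <= ((size g)%:R * m)%:E)%E.
Proof.
rewrite /cost; under eq_integral do rewrite -sumEFin.
rewrite ge0_integral_sum//; last first.
  by move=> e; apply/measurable_EFinP; exact: measurable_passage_time.
elim: g => [|e g IH]; first by rewrite big_nil mul0r.
by rewrite big_cons /= -natr1 mulrDl mul1r addrC EFinD leeD.
Qed.

Lemma markov_cost g c : 0 < c ->
  prob S [set eta | c <= cost eta g] <= (size g)%:R * m / c.
Proof.
move=> c0; set A := [set eta | _].
have mA : measurable A.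
  rewrite (_ : A = setT `&` (cost ^~ g) @^-1` `[c, +oo[%classic).
    exact: measurable_cost.
  by apply/seteqP; split=> eta /=; rewrite in_itv/= andbT => // -[].
have mc : measurable_fun setT (fun eta : Omega_S R d => (cost eta g)%:E).
  by apply/measurable_EFinP; exact: measurable_cost.
have cost0 (eta : Omega_S R d) : (0 <= (cost eta g)%:E)%E by rewrite lee_fin sumr_ge0.
rewrite ler_pdivlMr// -lee_fin; apply: le_trans (integral_cost_le g).
rewrite mulrC EFinM -probE// -integral_cst//.
apply: (@le_trans _ _ (\int[S]_(eta in A) (cost eta g)%:E)%E).
  apply: ge0_le_integral => //.
  - by move=> eta _; rewrite lee_fin ltW.
  - exact: measurable_funS mc.
exact: ge0_subset_integral.
Qed.

Definition short_walk x y (r : R) : set (Omega_E d) :=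
  [set w | exists2 g, open_walk w x g y & (size g)%:R <= r].

Lemma measurable_short_walk x y r : measurable (short_walk x y r).
Proof.
rewrite (_ : short_walk x y r = \bigcup_g
    [set w | open_walk w x g y /\ (size g)%:R <= r]).
  apply: countable_bigcupT_measurable => [|g]; first exact: countableP.
  have [gr|gr] := boolP ((size g)%:R <= r).
    rewrite (_ : [set w | _] = [set w | open_walk w x g y]).
      exact: measurable_open_walk.
    by apply/seteqP; split=> w // [].
  rewrite (_ : [set w | _] = set0) ?measurable0//.
  by apply/seteqP; split=> w // [].
by apply/seteqP; split=> w [g]; [exists g|move=> _ []; exists g].
Qed.

(** Restricting to G makes the bound of [prob_slow_short] proportional to the probability of G, so
    that it can be compared with that probability itself. *)
Definition slow_short (G : set (Omega_E d)) x y r c :=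
  ((G `&` short_walk x y r) `*` setT) `\` @fast R d x y c.

Lemma measurable_slow_short G x y r c : measurable G ->
  measurable (slow_short G x y r c).
Proof.
move=> mG; apply: measurableD; last exact: measurable_fast.
by apply: measurableX => //; apply: measurableI => //; exact: measurable_short_walk.
Qed.

(* Fubini, then Markov's inequality for the passage times along a short open walk
   chosen from the percolation configuration alone. *)
Lemma prob_slow_short G x y r c : measurable G -> 0 <= r -> 0 < c ->
  prob M (slow_short G x y r c) <= r * m / c * prob Pp G.
Proof.
move=> mG r0 c0; set X := slow_short G x y r c.
have mX : measurable X by exact: measurable_slow_short.
have k0 : 0 <= r * m / c by rewrite divr_ge0// ?mulr_ge0// ltW.
rewrite -lee_fin EFinM -!probE//.
rewrite [leLHS](_ : _ = (\int[Pp]_w S (xsection X w))%E)//.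
have -> : ((r * m / c)%:E * Pp G = \int[Pp]_w ((r * m / c)%:E * (\1_G w)%:E))%E.
  rewrite ge0_integralZl_EFin//; first by rewrite integral_indic// setIT.
  by apply/measurable_EFinP; exact: measurable_indic.
apply: ge0_le_integral => //.
- exact: measurable_fun_xsection.
- by apply: emeasurable_funM => //; apply/measurable_EFinP; exact: measurable_indic.
move=> w _; have mXw : measurable (xsection X w) by exact: measurable_xsection.
have [[Gw [g xgy gr]]|nGw] := pselect ((G `&` short_walk x y r) w); last first.
  rewrite (_ : xsection X w = set0) ?measure0 ?mule_ge0 ?lee_fin//.
  by rewrite -subset0 => eta; rewrite /xsection /= inE => -[[]].
rewrite indicE mem_set// mule1 probE// lee_fin.
apply: (@le_trans _ _ ((size g)%:R * m / c)); last first.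
  by rewrite ler_wpM2r ?invr_ge0 ?(ltW c0)// ler_wpM2r.
apply: le_trans (markov_cost g c0); apply: le_prob => //.
  rewrite (_ : [set eta | _] = setT `&` (cost ^~ g) @^-1` `[c, +oo[%classic).
    exact: measurable_cost.
  by apply/seteqP; split=> eta /=; rewrite in_itv/= andbT => // -[].
move=> eta; rewrite /xsection /= inE => -[_ nfast]; rewrite leNgt; apply/negP => gc.
by apply: nfast; apply/travel_time_ltP; exists g.
Qed.

Lemma l1norm_mulrn u n : l1norm (u *+ n) = l1norm u *+ n.
Proof.
rewrite /l1norm -sumrMnl; apply: eq_bigr => i _.
by rewrite mulmxnE -mulr_natr normrM normr_nat mulr_natr.
Qed.

Lemma l1norm_gt0 u : u != 0 -> 0 < l1norm u.
Proof.
move=> u0; rewrite lt_neqAle sumr_ge0// andbT eq_sym.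
apply: contraNneq u0 => /eqP; rewrite psumr_eq0// => /allP H.
apply/eqP/rowP => i; rewrite mxE; apply/eqP; rewrite -normr_eq0.
by have := H i; rewrite mem_index_enum; exact.
Qed.

(** If a exceeded s, then on [G n] the travel time would be bad, or no short walk would exist, or a
    short walk would be slow. The last case takes at most a fraction k < 1 of [G n], so the
    probability of [G n] would tend to 0, against mixing. *)
Lemma speed_le u a rho : u != 0 -> chemical_constant Pp rho -> has_speed Pp S u a ->
  a <= rho * m * (l1norm u)%:~R.
Proof.
move=> u0 [rho1 [A [B [A0 B0 AP]]]] ua; rewrite leNgt; apply/negP => ua_gt.
pose L : R := (l1norm u)%:~R.
have L0 : 0 < L by rewrite ltr0z l1norm_gt0.
have rho0 : 0 < rho by rewrite (lt_le_trans ltr01).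
pose s := rho * m * L; have s0 : 0 <= s by rewrite /s !mulr_ge0// ltW.
(* Then a - eps is the midpoint of s and a, whence k = s / (a - eps) < 1. *)
pose eps := (a - s) / 2; have eps0 : 0 < eps by rewrite divr_gt0// subr_gt0.
have c0 : 0 < a - eps by rewrite /eps; rewrite -/L -/s in ua_gt; lra.
pose k := s / (a - eps).
have k1 : 0 < 1 - k.
  by rewrite subr_gt0 ltr_pdivrMr// mul1r /eps; rewrite -/L -/s in ua_gt; lra.
pose G n := percolates 0 `&` percolates (u *+ n).
have mG n : measurable (G n) by apply: measurableI; exact: measurable_percolates.
(* This is the event of [chemical_constant] at n u, of geometrically small probability. *)
pose Far n := [set w | linked w 0 (u *+ n)] `\` short_walk 0 (u *+ n) (rho * (n%:R * L)).
have mFar n : measurable (Far n).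
  by apply: measurableD; [exact: measurable_linked|exact: measurable_short_walk].
have FarE n : prob Pp (Far n) <= A * expR (- B * L) ^+ n.
  have := AP (u *+ n); rewrite l1norm_mulrn -[l1norm u *+ n]mulr_natl intrM natz -/L.
  rewrite -pmulrn (_ : [set w | _] = Far n).
    by rewrite probE// lee_fin mulrCA expRM_natl.
  apply/seteqP; split=> w [wl].
    by move=> /gt_chemical_distanceP H; split=> // -[g /H]; rewrite ltNge => /negP.
  move=> nsw; split=> //; apply/gt_chemical_distanceP => g wg; rewrite ltNge.
  by apply/negP => gr; apply: nsw; exists g.
have Far0 : prob Pp (Far n) @[n --> \oo] --> (0 : R).
  apply: (squeeze_cvgr (f := fun=> 0) (h := geometric A (expR (- B * L)))).
  - by apply: nearW => n; rewrite prob_ge0 FarE.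
  - exact: cvg_cst.
  - apply: cvg_geometric; rewrite ger0_norm ?expR_ge0// expR_lt1.
    by rewrite mulNr oppr_lt0 mulr_gt0.
pose X n := slow_short (G n) 0 (u *+ n) (rho * (n%:R * L)) (n%:R * (a - eps)).
have XE n : (0 < n)%N -> prob M (X n) <= k * prob Pp (G n).
  move=> n0; have n0' : 0 < n%:R :> R by rewrite ltr0n.
  apply: le_trans (prob_slow_short _ _ _ _ _) _ => //.
  - by rewrite !mulr_ge0// ltW.
  - by rewrite mulr_gt0.
  rewrite (_ : _ / _ = k)// /k /s; field.
  by rewrite !gt_eqF.
have mX n : measurable (X n) by exact: measurable_slow_short.
have mB n : measurable (bad n 0 (u *+ n) a eps) by exact: measurable_bad.
have mGT n : measurable (G n `*` [set: Omega_S R d]) by exact: measurableX.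
have mFT n : measurable (Far n `*` [set: Omega_S R d]) by exact: measurableX.
have sub n : G n `*` setT `<=`
    bad n 0 (u *+ n) a eps `|` Far n `*` setT `|` X n.
  move=> we [[we0 weu] _]; have [|nbad] := pselect (bad n 0 (u *+ n) a eps we); first by left; left.
  have /andP[wa wb] := not_bad (conj we0 I) (conj weu I) nbad.
  (* The travel time is finite, so that 0 and n u are linked: uniqueness of the
     infinite cluster is not needed. *)
  have [fwe|nfwe] := pselect (short_walk 0 (u *+ n) (rho * (n%:R * L)) we.1); last first.
    left; right; split=> //; split=> //.
    by have /travel_time_ltP[g og _] := wb; exists g.
  by right; split; [split|rewrite /fast /= => /(le_lt_trans wa); rewrite ltxx].
have Gle n : (0 < n)%N -> (1 - k) * prob Pp (G n) <=
    prob M (bad n 0 (u *+ n) a eps) + prob Pp (Far n).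
  move=> n0; have mBF : measurable (bad n 0 (u *+ n) a eps `|` Far n `*` setT).
    exact: measurableU.
  have := le_prob M (mGT n) (measurableU _ _ mBF (mX n)) (sub n).
  have := le_probU M mBF (mX n); have := le_probU M (mB n) (mFT n).
  have JE Z : measurable Z -> prob M (Z `*` setT) = prob Pp Z.
    by move=> mZ; rewrite /prob joint_setXT.
  by rewrite !JE//; have := XE n n0; lra.
have t3 : 0 < (1 - k) * theta ^+ 3 / 2 by rewrite divr_gt0// mulr_gt0// exprn_gt0.
have t2 : 0 < theta ^+ 3 / 2 by rewrite divr_gt0// exprn_gt0.
(* Adding the point 2 n u to the pair only shrinks [G n], so the limit [theta ^+ 3] for the triple
   gives an eventual lower bound for the pair. *)
have /andP[u20 uu2] := double_neq u0.
have /cvgrPdist_lt/(_ _ t2) nearG := percolates_mixing PpE u0 u20 uu2.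
have : prob M (bad n 0 (u *+ n) a eps) + prob Pp (Far n) @[n --> \oo] --> (0 : R).
  by rewrite -(addr0 (0 : R)); apply: cvgD => //; exact: ua.
move=> /cvgrPdist_lt/(_ _ t3) nearB.
near \oo => n.
have n0 : (0 < n)%N by near: n; exact: nbhs_infty_gt.
have Gn : `|theta ^+ 3 - prob Pp (G n `&` percolates (u *+ 2 *+ n))| < theta ^+ 3 / 2 by near: n.
have Bn : `|0 - (prob M (bad n 0 (u *+ n) a eps) + prob Pp (Far n))| <
    (1 - k) * theta ^+ 3 / 2 by near: n.
have G3 : prob Pp (G n `&` percolates (u *+ 2 *+ n)) <= prob Pp (G n).
  apply: le_prob; [|exact: mG|exact: subIsetl].
  by apply: measurableI; [exact: mG|exact: measurable_percolates].
have Gt : theta ^+ 3 / 2 < prob Pp (G n).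
  by move: Gn; rewrite ltr_norml => /andP[_]; lra.
have := Gle n n0; have : (1 - k) * (theta ^+ 3 / 2) < (1 - k) * prob Pp (G n).
  by rewrite ltr_pM2l.
by move: Bn; rewrite ltr_norml => /andP[Bn _]; lra.
Unshelve. all: by end_near. Qed.

End speed_bound.

(** * Properties of the speed *)

(** An edge exists as soon as d > 0, so the supremum is not that of an empty family, which would be
    -oo. *)
Lemma sup_mean_ge0 (R : realType) (d : nat) (S : probability (Omega_S R d) R) :
  (0 < d)%N -> (0 <= sup_mean S)%E.
Proof.
case: d S => // d S _.
have ed : is_edge [fset (0 : 'rV[int]_d.+1); delta_mx 0 0]%fset.
  apply/asboolP; exists 0, (delta_mx 0 0); split=> //.
  rewrite (bigD1 0)//= big1 => [|i /negPf i0].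
    by rewrite !mxE eqxx /= sub0r sqrrN expr1n addr0.
  by rewrite !mxE i0 /= subr0 expr0n.
pose e : edge d.+1 := exist (fun f => is_true (is_edge f)) _ ed.
apply: (@le_trans _ _ (\int[S]_eta (eta e)%:num%:E)%E).
  by apply: integral_ge0 => eta _; rewrite lee_fin.
by apply: ereal_sup_ubound; exists e.
Qed.

Theorem theorem3p2 (R : realType) (d : nat) (d_ge2 : (2 <= d)%N)
    (p : R) (p_gt : critical_probability R d < p) (p_le1 : p <= 1)
    (Pp : probability (Omega_E d) R) (PpE : iid_law (bernoulli_prob p) Pp)
    (rho : R) (rhoP : chemical_constant Pp rho)
    (Snu : probability (Omega_S R d) R)
    (S_stationary : stationary Snu) (S_ergodic : ergodic Snu)
    (m_fin : (sup_mean Snu < +oo)%E)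
    (alpha : R) (alpha_gt1 : 1 < alpha) (S_H : H_ Snu alpha)
    (f : 'rV[int]_d -> R)
    (fP : forall u : 'rV[int]_d, u != 0 -> 0 <= f u /\
       {ae Pbar Pp Snu, forall we,
          (travel_time we.1 we.2 0 (u *+ T_ we.1 n u) * n%:R^-1%:E)%E
            @[n --> \oo] --> (f u)%:E}) :
  let mu := mu_ Pp f in
  (forall u : 'rV[int]_d, u != 0 ->
     {ae Pbar Pp Snu, forall we,
        (travel_time we.1 we.2 0 (u *+ T_ we.1 n u)
           * (T_ we.1 n u)%:R^-1%:E)%E
          @[n --> \oo] --> (mu u)%:E}) /\
  (forall u, 0 <= mu u) /\
  (forall u, mu (- u) = mu u) /\
  ((exists nu : probability (nnreal R) R, iid_law nu Snu) ->
     (forall (s : 'S_d) u, mu (col_perm s u) = mu u) /\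
     (forall (i : 'I_d) u, mu (reflect_coord i u) = mu u)) /\
  (forall (k : int) u, mu (k *: u) = `|k|%:~R * mu u) /\
  (forall u, ((mu u)%:E <= rho%:E * sup_mean Snu * (l1norm u)%:~R%:E)%E) /\
  (forall u, mu u <= mu_star mu * (l1norm u)%:~R) /\
  (forall u v, mu (u + v) <= mu u + mu v) /\
  (forall u v, `|mu u - mu v| <= mu_star mu * (l1norm (u - v))%:~R).

Proof.
move=> mu.
have theta0 := theta_gt0 p_gt p_le1 PpE; set theta := prob Pp (percolates 0) in theta0.
have muE u : u != 0 -> mu u = theta * f u by rewrite /mu /mu_ => /negPf ->.
have mu0 : mu 0 = 0 by rewrite /mu /mu_ eqxx.
have muT u : u != 0 -> {ae Pbar Pp Snu, forall we,
    (travel_time we.1 we.2 0 (u *+ T_ we.1 n u) * (T_ we.1 n u)%:R^-1%:E)%E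
      @[n --> \oo] --> (mu u)%:E}.
  by move=> u0; rewrite muE//; apply: (ae_cvg_travel_time_T PpE theta0 u0); have [] := fP u u0.
have speed u : u != 0 -> has_speed Pp Snu u (mu u).
  by move=> u0; apply: (cvg_has_speed PpE theta0 u0); exact: muT.
(* The identities for [mu] under negation, multiples and isomorphisms come from exhibiting a speed
   and invoking uniqueness. *)
have uniq u a : u != 0 -> has_speed Pp Snu u a -> a = mu u.
  by move=> u0 ua; apply: (has_speed_unique PpE theta0 u0 ua); exact: speed.
have mu_ge0 u : 0 <= mu u.
  have [->|u0] := eqVneq u 0; first by rewrite mu0.
  by rewrite muE// mulr_ge0 ?(ltW theta0)//; have [] := fP u u0.
have muN u : mu (- u) = mu u.
  have [->|u0] := eqVneq u 0; first by rewrite oppr0.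
  apply/esym/uniq; first by rewrite oppr_eq0.
  by apply: (has_speed_opp PpE S_stationary); exact: speed.
have muMn u n : mu (u *+ n) = n%:R * mu u.
  have [->|u0] := eqVneq u 0; first by rewrite mul0rn mu0 mulr0.
  case: n => [|n]; first by rewrite mulr0n mu0 mul0r.
  apply/esym/uniq; last by apply: has_speed_mulrn => //; exact: speed.
  apply: contraNneq u0 => /rowP H; apply/eqP/rowP => i; have /eqP := H i.
  by rewrite mulmxnE mxE mulrn_eq0 => /eqP.
have muZ (k : int) u : mu (k *: u) = `|k|%:~R * mu u.
  case: k => n; first by rewrite -[Posz n]natz scaler_nat muMn normr_nat natz -pmulrn.
  by rewrite NegzE scaleNr muN normrN -[Posz _]natz scaler_nat muMn normr_nat natz -pmulrn.
have muD u v : mu (u + v) <= mu u + mu v.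
  have [->|u0] := eqVneq u 0; first by rewrite add0r mu0 add0r.
  have [->|v0] := eqVneq v 0; first by rewrite addr0 mu0 addr0.
  have [->|uv0] := eqVneq (u + v) 0; first by rewrite mu0 addr_ge0.
  by apply: (has_speed_subadditive PpE S_stationary theta0 u0 v0 uv0); exact: speed.
(* Both product laws are invariant under the permutation of edges induced by an isomorphism, so
   speeds are transported. *)
have mu_iso (s : lattice_iso d) u : (forall n v, s (v *+ n) = s v *+ n) ->
    (exists nu : probability (nnreal R) R, iid_law nu Snu) -> mu (s u) = mu u.
  move=> sM [nu SE].
  have s0 : s 0 = 0 by have := sM 0%N 0; rewrite !mulr0n.
  have [->|u0] := eqVneq u 0; first by rewrite s0.
  apply/esym/uniq; first by rewrite -s0 (inj_eq (can_inj (isoK s))).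
  apply: has_speed_iso => //; last exact: speed.
  by apply: joint_pull2 => X mX;
    [rewrite (iid_pull PpE (iso_edgeK s))|rewrite (iid_pull SE (iso_edgeK s))].
have mu_le_star u : mu u <= mu_star mu * (l1norm u)%:~R.
  have le_star i : mu (delta_mx 0 i) <= mu_star mu.
    apply: ub_le_sup; last by exists i.
    (* The sum over all basis vectors bounds each of its nonnegative terms, so the range is bounded
       above and [sup] is not a default value. *)
    exists (\sum_j mu (delta_mx 0 j)) => _ [j _ <-].
    by rewrite (bigD1 j)//= lerDl sumr_ge0.
  (* In the canonical basis, subadditivity and homogeneity apply term by term. *)
  rewrite [in leLHS](row_sum_delta u) /l1norm rmorph_sum mulr_sumr.
  apply: (big_ind2 (fun x y => mu x <= y)) => [|x a y b xa yb|i _].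
  - by rewrite mu0.
  - exact: le_trans (muD _ _) (lerD xa yb).
  - by rewrite muZ mulrC ler_wpM2r// ler0z.
split; first exact: muT.
split; first exact: mu_ge0.
split; first exact: muN.
split.
  move=> iid; split=> [s u|i u].
    by apply: (mu_iso (col_perm_iso s)) => // n v; rewrite /= linearMn.
  apply: (mu_iso (reflect_iso i)) => // n v.
  by apply/rowP => j; rewrite !(mxE, mulmxnE); case: ifP => // _; rewrite mulNrn.
split; first exact: muZ.
split.
  move=> u; have m0 := sup_mean_ge0 Snu (leq_trans _ d_ge2).
  have mE : sup_mean Snu = (fine (sup_mean Snu))%:E by rewrite fineK// ge0_fin_numE// m0.
  rewrite mE -!EFinM lee_fin.
  have [->|u0] := eqVneq u 0.
    by rewrite mu0 /l1norm big1 ?mulr0// => i _; rewrite mxE normr0.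
  apply: (speed_le PpE theta0 _ _ u0 rhoP); last exact: speed.
    by move=> e; rewrite -mE; apply: ereal_sup_ubound; exists e.
  by rewrite fine_ge0// m0.
split=> //; split=> // u v.
(* Subadditivity for x = (x - y) + y. *)
have muB x y : mu x - mu y <= mu_star mu * (l1norm (x - y))%:~R.
  by have := muD (x - y) y; have := mu_le_star (x - y); rewrite subrK; lra.
have l1C : l1norm (v - u) = l1norm (u - v).
  by rewrite -opprB; apply: eq_bigr => i _; rewrite mxE normrN.
by rewrite ler_norml muB andbT lerNl opprB -l1C.
Qed.
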